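(* Let $(M^n,g)$ be a complete, Ricci-flat ALE manifold of order $\tau>\frac{n-2}2$, with $n\ge4$. Suppose there exists a symmetric 2-tensor $h\in\Gamma(S^2T^*M)$ satisfying: - $\Delta_Lh=0$, where $\Delta_Lh:=\nabla^*\nabla h+\mathfrak{Ric}(h)$ and $\mathfrak{Ric}(h)=\mathrm{Rm}*h$; - $\delta h=0$ and $\operatorname{tr}_gh=0$; - $|h(x)|=O(r^{-\alpha})$ for some $\alpha>\frac n2$; - the curvature term satisfies $\langle\mathrm{Rm}*h,h\rangle\le0$ pointwise on $M$. Then either $h\equiv0$, or the ADM mass of $(M,g)$ vanishes.
   Context: ALE (asymptotically locally Euclidean) of order $\tau$: there are a compact set $C\subset M$, a finite group $\Gamma\subset O(n)$ acting freely on $S^{n-1}$ and a diffeomorphism $M\setminus C\cong(\mathbb R^n\setminus\overline B)/\Gamma$ ($\overline B$ a closed ball) in which $g_{ij}=\delta_{ij}+O(r^{-\tau})$, with $\partial^kg_{ij}=O(r^{-\tau-k})$ for the derivatives; $r$ is the Euclidean radius in these coordinates. The ADM mass is, up to a positive dimensional normalizing constant, $\lim_{r\to\infty}\int_{S_r/\Gamma}(\partial_ig_{ij}-\partial_jg_{ii})\nu^j\,d\sigma$. The operator $\mathfrak{Ric}(h)$, also written $\mathrm{Rm}*h$ (a contraction of the curvature with $h$), is the zeroth-order term of the Lichnerowicz Laplacian: let $\mathfrak R:\Lambda^2TM\to\Lambda^2TM$ be the curvature operator $g(\mathfrak R(X\wedge Y),Z\wedge W)=\mathrm{Rm}(X,Y,Z,W)$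 (sign such that it equals $K\cdot\mathrm{id}$ in constant curvature $K$), identify $\Lambda^2T_xM\cong\mathfrak{so}(T_xM)$, let $L\in\mathfrak{so}(T_xM)$ act by $(Lh)(X,Y)=-h(LX,Y)-h(X,LY)$; then $\mathfrak{Ric}(h)=-\sum_\alpha\mathfrak R(\Xi_\alpha)(\Xi_\alpha h)$ for an orthonormal basis $\{\Xi_\alpha\}$ of $\Lambda^2T_xM$. $\nabla^*$ is the formal adjoint of $\nabla$, so $\nabla^*\nabla=-\mathrm{tr}\,\nabla^2$; $\delta h=-\sum_i(\nabla_{e_i}h)(e_i,\cdot)$. *)

(* Defs.v *)
(* Tensors are treated in local components: a point of R^n is a row vector,
   a symmetric 2-tensor on an open set of R^n is a matrix-valued function
   'rV[R]_n -> 'M[R]_n, and a tensor on a manifold is a family of such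
   functions, one per chart, subject to the usual transformation law. *)
From HB Require Import structures.
From mathcomp Require Import all_boot all_order all_algebra finmap.
From mathcomp Require Import all_classical all_reals all_analysis.
Set Implicit Arguments.
Unset Strict Implicit.
Unset Printing Implicit Defensive.
Import Order.TTheory GRing.Theory Num.Theory.
Import numFieldNormedType.Exports.
Local Open Scope classical_set_scope.
Local Open Scope ring_scope.

(** * Calculus on open subsets of R^n *)

(* The library topology on 'rV[R]_n comes from the sup norm; radii, balls and
   spheres below use this Euclidean norm. *)
Definition enorm (R : realType) (n : nat) (x : 'rV[R]_n) : R :=
  Num.sqrt (\sum_i x 0 i ^+ 2).

Definition partial (R : realType) (n : nat) (i : 'I_n) (f : 'rV[R]_n -> R) :
    'rV[R]_n -> R :=
  fun x => 'D_(delta_mx 0 i) f x.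

Definition partials (R : realType) (n : nat) (s : seq 'I_n)
    (f : 'rV[R]_n -> R) : 'rV[R]_n -> R :=
  foldr (@partial R n) f s.

(* C^oo on U, meant for open U. *)
Definition smooth_on (R : realType) (n : nat) (U : set 'rV[R]_n)
    (f : 'rV[R]_n -> R) : Prop :=
  forall (s : seq 'I_n) (x : 'rV[R]_n), U x -> differentiable (partials s f) x.

Definition smooth_map_on (R : realType) (n m : nat) (U : set 'rV[R]_n)
    (F : 'rV[R]_n -> 'rV[R]_m) : Prop :=
  forall k : 'I_m, smooth_on U (fun x => F x 0 k).

(* With J = jacobian F x, J i k = d_i F^k, so this is the pullback by dF_x of a
   bilinear form with matrix A. *)
Definition pull_form (R : realType) (n : nat) (F : 'rV[R]_n -> 'rV[R]_n)
    (x : 'rV[R]_n) (A : 'M[R]_n) : 'M[R]_n :=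
  let J := jacobian F x in J *m A *m J^T.

(** * Smooth manifolds *)

Record chart (R : realType) (n : nat) (M : topologicalType) := Chart {
  cdom : set M;
  cmap : M -> 'rV[R]_n;
  cinv : 'rV[R]_n -> M }.

Definition cimg (R : realType) (n : nat) (M : topologicalType)
    (c : chart R n M) : set 'rV[R]_n :=
  cmap c @` cdom c.

Definition is_chart (R : realType) (n : nat) (M : topologicalType)
    (c : chart R n M) : Prop :=
  [/\ open (cdom c), open (cimg c),
      forall p, cdom c p -> cinv c (cmap c p) = p,
      forall p, cdom c p -> {for p, continuous (cmap c)}
    & forall x, cimg c x -> {for x, continuous (cinv c)}].

Definition smooth_transition (R : realType) (n : nat) (M : topologicalType)
    (c d : chart R n M) : Prop :=
  smooth_map_on (cmap c @` (cdom c `&` cdom d)) (cmap d \o cinv c).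

(* The smooth structure is a maximal atlas. *)
Record manifold (R : realType) (n : nat) := Manifold {
  carrier :> topologicalType;
  manifold_hausdorff : hausdorff_space carrier;
  manifold_second_countable : @second_countable carrier;
  atlas : set (chart R n carrier);
  atlas_chart : forall c, atlas c -> is_chart c;
  atlas_cover : forall p : carrier, exists c, atlas c /\ cdom c p;
  atlas_compat : forall c d, atlas c -> atlas d -> smooth_transition c d;
  atlas_max : forall c, is_chart c ->
    (forall d, atlas d -> smooth_transition c d /\ smooth_transition d c) ->
    atlas c }.

Definition chart_at (R : realType) (n : nat) (M : manifold R n) (p : M) :
    chart R n M :=
  sval (cid (atlas_cover p)).

(** * Symmetric 2-tensors and Riemannian metrics *)

Record sym2 (R : realType) (n : nat) (M : manifold R n) := Sym2 {
  comp :> chart R n M -> 'rV[R]_n -> 'M[R]_n;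
  comp_smooth : forall c, atlas c ->
    forall i j, smooth_on (cimg c) (fun x => comp c x i j);
  comp_sym : forall c x, atlas c -> cimg c x -> (comp c x)^T = comp c x;
  comp_transform : forall c d p, atlas c -> atlas d -> cdom c p -> cdom d p ->
    comp c (cmap c p) =
    pull_form (cmap d \o cinv c) (cmap c p) (comp d (cmap d p)) }.

Record metric (R : realType) (n : nat) (M : manifold R n) := Metric {
  metric_tensor :> sym2 M;
  metric_pos : forall c x, atlas c -> cimg c x ->
    forall v : 'rV[R]_n, v != 0 -> 0 < (v *m metric_tensor c x *m v^T) 0 0 }.

Definition sym2_zero (R : realType) (n : nat) (M : manifold R n)
    (h : sym2 M) : Prop :=
  forall c x, atlas c -> cimg c x -> h c x = 0.

(** * Riemannian geometry in coordinates

    G is the matrix of the metric and h the matrix of a symmetric 2-tensor, as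
    functions of the coordinates. *)

Definition ginv (R : realType) (n : nat) (G : 'rV[R]_n -> 'M[R]_n)
    (x : 'rV[R]_n) : 'M[R]_n :=
  invmx (G x).

(* christoffel G k i j = Gamma^k_{ij} *)
Definition christoffel (R : realType) (n : nat) (G : 'rV[R]_n -> 'M[R]_n)
    (k i j : 'I_n) (x : 'rV[R]_n) : R :=
  2^-1 * \sum_l ginv G x k l *
    (partial i (fun y => G y j l) x + partial j (fun y => G y i l) x
     - partial l (fun y => G y i j) x).

(* R(d_i, d_j) d_k = sum_l (curv G l i j k) d_l, where
   R(X,Y) = [nabla_X, nabla_Y] - nabla_[X,Y]. *)
Definition curv (R : realType) (n : nat) (G : 'rV[R]_n -> 'M[R]_n)
    (l i j k : 'I_n) (x : 'rV[R]_n) : R :=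
  partial i (christoffel G l j k) x - partial j (christoffel G l i k) x
  + \sum_m (christoffel G l i m x * christoffel G m j k x
            - christoffel G l j m x * christoffel G m i k x).

(* Rm(X,Y,Z,W) = g(R(X,Y)W, Z), so that in constant curvature K
   Rm(X,Y,Z,W) = K (g(X,Z) g(Y,W) - g(X,W) g(Y,Z)) = K g(X/\Y, Z/\W). *)
Definition Rm (R : realType) (n : nat) (G : 'rV[R]_n -> 'M[R]_n)
    (i j k l : 'I_n) (x : 'rV[R]_n) : R :=
  \sum_m G x k m * curv G m i j l x.

Definition ricci (R : realType) (n : nat) (G : 'rV[R]_n -> 'M[R]_n)
    (x : 'rV[R]_n) : 'M[R]_n :=
  \matrix_(j, l) \sum_i curv G i i j l x.

(* (nabla_k h)_{ij} *)
Definition cov (R : realType) (n : nat) (G h : 'rV[R]_n -> 'M[R]_n)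
    (k i j : 'I_n) (x : 'rV[R]_n) : R :=
  partial k (fun y => h y i j) x
  - \sum_m (christoffel G m k i x * h x m j + christoffel G m k j x * h x i m).

(* (nabla^2 h)(d_l, d_k; d_i, d_j), the covariant derivative of nabla h. *)
Definition cov2 (R : realType) (n : nat) (G h : 'rV[R]_n -> 'M[R]_n)
    (l k i j : 'I_n) (x : 'rV[R]_n) : R :=
  partial l (cov G h k i j) x
  - \sum_m (christoffel G m l k x * cov G h m i j x
            + christoffel G m l i x * cov G h k m j x
            + christoffel G m l j x * cov G h k i m x).

(* nabla^* nabla h = - tr nabla^2 h *)
Definition rough_laplacian (R : realType) (n : nat)
    (G h : 'rV[R]_n -> 'M[R]_n) (x : 'rV[R]_n) : 'M[R]_n :=
  \matrix_(i, j) - \sum_l \sum_k ginv G x l k * cov2 G h l k i j x.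

Definition divergence (R : realType) (n : nat) (G h : 'rV[R]_n -> 'M[R]_n)
    (x : 'rV[R]_n) : 'rV[R]_n :=
  \row_j - \sum_i \sum_k ginv G x i k * cov G h i k j x.

Definition trace_g (R : realType) (n : nat) (G h : 'rV[R]_n -> 'M[R]_n)
    (x : 'rV[R]_n) : R :=
  \sum_i \sum_j ginv G x i j * h x i j.

Definition inner_g (R : realType) (n : nat) (G : 'rV[R]_n -> 'M[R]_n)
    (x : 'rV[R]_n) (a b : 'M[R]_n) : R :=
  \sum_i \sum_j \sum_k \sum_l ginv G x i k * ginv G x j l * a i j * b k l.

Definition norm_g (R : realType) (n : nat) (G : 'rV[R]_n -> 'M[R]_n)
    (x : 'rV[R]_n) (a : 'M[R]_n) : R :=
  Num.sqrt (inner_g G x a a).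

(** ** Bivectors and the curvature term

    A bivector is an antisymmetric matrix A^{ij}; X /\ Y has components
    X^i Y^j - Y^i X^j. *)

(* <X/\Y, Z/\W> = g(X,Z) g(Y,W) - g(X,W) g(Y,Z) *)
Definition bivec_inner (R : realType) (n : nat) (G : 'rV[R]_n -> 'M[R]_n)
    (x : 'rV[R]_n) (A B : 'M[R]_n) : R :=
  2^-1 * \sum_i \sum_j \sum_k \sum_l G x i k * G x j l * A i j * B k l.

(* The operator with <curv_op (X/\Y), Z/\W> = Rm(X,Y,Z,W). *)
Definition curv_op (R : realType) (n : nat) (G : 'rV[R]_n -> 'M[R]_n)
    (x : 'rV[R]_n) (A : 'M[R]_n) : 'M[R]_n :=
  \matrix_(k, l) (2^-1 * \sum_i \sum_j \sum_p \sum_q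
    A i j * Rm G i j p q x * ginv G x p k * ginv G x q l).

(* The skew endomorphism identified with a bivector:
   X/\Y is Z |-> g(Y,Z) X - g(X,Z) Y, with matrix L k j = L^k_j.  The opposite
   identification gives the same operator lich_curv below. *)
Definition bivec_so (R : realType) (n : nat) (G : 'rV[R]_n -> 'M[R]_n)
    (x : 'rV[R]_n) (A : 'M[R]_n) : 'M[R]_n :=
  A *m G x.

(* (L h)(X,Y) = - h(LX,Y) - h(X,LY) *)
Definition so_act (R : realType) (n : nat) (L h : 'M[R]_n) : 'M[R]_n :=
  \matrix_(i, j) - \sum_k (L k i * h k j + L k j * h i k).

Definition is_bivec_onb (R : realType) (n : nat) (G : 'rV[R]_n -> 'M[R]_n)
    (x : 'rV[R]_n) (Xi : 'I_('C(n, 2)) -> 'M[R]_n) : Prop :=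
  (forall a, (Xi a)^T = - Xi a) /\
  (forall a b, bivec_inner G x (Xi a) (Xi b) = (a == b)%:R).

(* An arbitrary choice; the default value 0 is never used when G x is positive
   definite. *)
Definition bivec_onb (R : realType) (n : nat) (G : 'rV[R]_n -> 'M[R]_n)
    (x : 'rV[R]_n) : 'I_('C(n, 2)) -> 'M[R]_n :=
  xget (fun=> 0) [set Xi | is_bivec_onb G x Xi].

(* Rm * h = - sum_a curv_op(Xi_a) . (Xi_a . h) *)
Definition lich_curv (R : realType) (n : nat) (G h : 'rV[R]_n -> 'M[R]_n)
    (x : 'rV[R]_n) : 'M[R]_n :=
  - \sum_a so_act (bivec_so G x (curv_op G x (bivec_onb G x a)))
             (so_act (bivec_so G x (bivec_onb G x a)) (h x)).

Definition lichnerowicz (R : realType) (n : nat) (G h : 'rV[R]_n -> 'M[R]_n)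
    (x : 'rV[R]_n) : 'M[R]_n :=
  rough_laplacian G h x + lich_curv G h x.

(** * Global notions on a Riemannian manifold *)

Definition ricci_flat (R : realType) (n : nat) (M : manifold R n)
    (g : metric M) : Prop :=
  forall c x, atlas c -> cimg c x -> ricci (g c) x = 0.

(* k-th coordinate of a curve in a chart. *)
Definition curve_coord (R : realType) (n : nat) (M : manifold R n)
    (c : chart R n M) (gam : R -> M) (k : 'I_n) : R -> R :=
  fun t => cmap c (gam t) 0 k.

Definition is_geodesic (R : realType) (n : nat) (M : manifold R n)
    (g : metric M) (gam : R -> M) : Prop :=
  continuous gam /\
  forall c t, atlas c -> cdom c (gam t) -> forall k,
    let u := curve_coord c gam in
    [/\ derivable (u k) t 1, derivable (derive1 (u k)) t 1
      & derive1 (derive1 (u k)) t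
        + \sum_i \sum_j christoffel (g c) k i j (cmap c (gam t))
                        * derive1 (u i) t * derive1 (u j) t = 0].

(* Every tangent vector is the initial velocity of a geodesic defined on the
   whole real line. *)
Definition complete (R : realType) (n : nat) (M : manifold R n)
    (g : metric M) : Prop :=
  forall c p, atlas c -> cdom c p -> forall v : 'rV[R]_n,
    exists gam : R -> M,
      [/\ is_geodesic g gam, gam 0 = p
        & forall k, derive1 (curve_coord c gam k) 0 = v 0 k].

(** * ALE ends *)

(* Complement of the closed ball of radius r. *)
Definition outside (R : realType) (n : nat) (r : R) : set 'rV[R]_n :=
  [set x | r < enorm x].

Definition is_big_O (R : realType) (n : nat) (f : 'rV[R]_n -> R) (a : R) :
    Prop :=
  exists K r0 : R, 0 < r0 /\
    forall x, r0 <= enorm x -> `|f x| <= K * enorm x `^ a.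

(* Matrix at x of the pullback of a 2-tensor by F : R^n -> M; by
   comp_transform it does not depend on the chart used. *)
Definition pullback (R : realType) (n : nat) (M : manifold R n) (h : sym2 M)
    (F : 'rV[R]_n -> M) (x : 'rV[R]_n) : 'M[R]_n :=
  let c := chart_at (F x) in
  pull_form (cmap c \o F) x (h c (cmap c (F x))).

(* The group acts on row vectors by x |-> x *m s.  The diffeomorphism
   (R^n \ B) / Gamma -> M \ C is given by its composite ale_map with the
   quotient map: a smooth map on R^n \ B with values in M \ C whose fibres are
   exactly the Gamma-orbits.  Since R^n \ B -> (R^n \ B) / Gamma is a covering,
   smoothness of the inverse means that it lifts locally to smooth maps into
   R^n \ B (ale_lift); this also gives surjectivity onto M \ C. *)
Record ALE (R : realType) (n : nat) (M : manifold R n) (g : metric M)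
    (tau : R) := MkALE {
  ale_core : set M;
  ale_core_compact : compact ale_core;
  ale_group : {fset 'M[R]_n};
  ale_group1 : 1%:M \in ale_group;
  ale_groupM : forall s t, s \in ale_group -> t \in ale_group ->
    s *m t \in ale_group;
  ale_groupV : forall s, s \in ale_group -> invmx s \in ale_group;
  ale_group_orth : forall s, s \in ale_group -> s *m s^T = 1%:M;
  ale_group_free : forall s (x : 'rV[R]_n), s \in ale_group -> enorm x = 1 ->
    x *m s = x -> s = 1%:M;
  ale_radius : R;
  ale_radius_gt0 : 0 < ale_radius;
  ale_map : 'rV[R]_n -> M;
  ale_map_core : forall x, outside ale_radius x -> ~ ale_core (ale_map x);
  ale_map_fibre : forall x y, outside ale_radius x -> outside ale_radius y ->
    ale_map x = ale_map y <-> exists2 s, s \in ale_group & y = x *m s;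
  ale_map_continuous : forall x, outside ale_radius x ->
    {for x, continuous ale_map};
  ale_map_smooth : forall c, atlas c ->
    smooth_map_on [set x | outside ale_radius x /\ cdom c (ale_map x)]
                  (cmap c \o ale_map);
  ale_lift : forall p, ~ ale_core p ->
    exists (W : set M) (sig : M -> 'rV[R]_n),
      [/\ open W, W p,
          forall q, W q -> outside ale_radius (sig q) /\ ale_map (sig q) = q
        & forall c, atlas c ->
            smooth_map_on (cmap c @` (W `&` cdom c)) (sig \o cinv c)];
  ale_decay : forall (s : seq 'I_n) (i j : 'I_n),
    is_big_O
      (partials s (fun x => pullback g ale_map x i j - (i == j)%:R))
      (- tau - (size s)%:R) }.

(** * The ADM mass *)

(* Integral over the unit sphere S^{n-1} of R^n for the Euclidean surface
   measure, in polar coordinates: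
   (cos t, sin t * w), with t in [0, pi] and w in S^k, parametrizes S^{k+1} and
   d sigma_{k+1} = (sin t)^k dt d sigma_k.  S^0 = {1, -1} has counting measure. *)
Fixpoint sphere_integral (R : realType) (n : nat) :
    ('rV[R]_n -> R) -> R :=
  match n with
  | 0 => fun=> 0
  | m.+1 =>
    match m as m0 return
      (('rV[R]_m0 -> R) -> R) -> ('rV[R]_m0.+1 -> R) -> R with
    | 0 => fun _ f => f (const_mx 1) + f (const_mx (-1))
    | k.+1 => fun rec f =>
        \int[lebesgue_measure]_(t in `[0, pi])
          (sin t ^+ k *
           rec (fun w : 'rV[R]_k.+1 =>
                  f (row_mx (const_mx (cos t) : 'rV[R]_1) (sin t *: w))))
    end (@sphere_integral R m)
  end.

(* Integral over the sphere S_r of radius r. *)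
Definition sphere_integral_r (R : realType) (n : nat) (r : R)
    (f : 'rV[R]_n -> R) : R :=
  r ^+ n.-1 * sphere_integral (fun w => f (r *: w)).

Definition adm_integrand (R : realType) (n : nat) (G : 'rV[R]_n -> 'M[R]_n)
    (x : 'rV[R]_n) : R :=
  \sum_j \sum_i
    (partial i (fun y => G y i j) x - partial j (fun y => G y i i) x)
    * (x 0 j / enorm x).

(* The integral over S_r / Gamma of a Gamma-invariant function is its integral
   over S_r divided by the order of Gamma, which acts freely on S_r. *)
Definition adm_flux (R : realType) (n : nat) (M : manifold R n) (g : metric M)
    (tau : R) (E : ALE g tau) (r : R) : R :=
  sphere_integral_r r (adm_integrand (pullback g (ale_map E)))
  / (#|` ale_group E|)%:R.

(* The mass, up to its positive dimensional constant, exists and equals m. *)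
Definition adm_mass_is (R : realType) (n : nat) (M : manifold R n)
    (g : metric M) (tau : R) (E : ALE g tau) (m : R) : Prop :=
  adm_flux E r @[r --> +oo] --> m.

(* |h| = O(r^a) at infinity. *)
Definition tensor_big_O (R : realType) (n : nat) (M : manifold R n)
    (g : metric M) (tau : R) (E : ALE g tau) (h : sym2 M) (a : R) : Prop :=
  is_big_O
    (fun x => let p := ale_map E x in let c := chart_at p in
              norm_g (g c) (cmap c p) (h c (cmap c p))) a.

(* Main.v *)
Require Import Defs.
From HB Require Import structures.
From mathcomp Require Import all_boot all_order all_algebra finmap.
From mathcomp Require Import all_classical all_reals all_analysis.
From mathcomp Require Import ring lra.
Import Order.TTheory GRing.Theory Num.Theory.
Import numFieldNormedType.Exports.
Local Open Scope classical_set_scope.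
Local Open Scope ring_scope.
Set Implicit Arguments.
Unset Strict Implicit.
Unset Printing Implicit Defensive.

(* The second alternative always holds, because g is Ricci-flat.  Near infinity
   put e = g - delta and U_j = d_i e_ij - d_j e_ii, and let P be the linearized
   Ricci tensor of e, with Euclidean trace S.  As Ric = 0, P is a sum of terms
   at least quadratic in e and its derivatives, hence P = O(r^(-2 tau - 2)).
   The linearized Einstein tensor is a divergence,
     P_jl - 1/2 delta_jl S = d_i K_ijl,   K antisymmetric in (i, j),
   so contracting with the position vector x_l and setting A_ij = x_l K_ijl,
     x_l (P_jl - 1/2 delta_jl S) = d_i A_ij - (n - 2)/2 U_j.
   On a sphere of radius r the flux of d_i A_ij is an integral of the rotation
   fields x_j d_i - x_i d_j applied to A_ij, which vanishes, and the flux of the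
   left-hand side is O(r^(n - 2 - 2 tau)).  So the flux of U tends to 0. *)

(** * Partial derivatives *)

(** Counting powers shows what the curvature equation buys: U is only O(r^(-tau - 1)), so its flux
    is a priori O(r^(n - 2 - tau)), which need not decay, whereas area, position vector and P
    together give r^(n - 1) r r^(-2 tau - 2), and n - 2 - 2 tau is negative precisely when tau > (n
    - 2)/2. Contracting with x_l rather than with a constant vector is what makes U appear:
    differentiating x_l produces the trace of K over its indices i and l, which is (n - 2)/2 U_j.
    The sphere integral is an iterated integral in polar angles, with no rotation invariance built
    in. That rotation fields integrate to zero is therefore proved by induction on the dimension; a
    rotation that moves the polar axis needs an integration by parts in the angle and another one
    along the slices. The pullback of g is computed at each point in a chosen chart, which may jump
    from point to point. Local inverses of the ALE map remove this choice, so that smoothness and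
    Ricci-flatness pass to the pullback. *)

Lemma near_eq_differentiable (R : realType) (V W : normedModType R)
  (f g : V -> W) x : {near x, f =1 g} -> differentiable f x -> differentiable g x.
Proof.
move=> fg df; apply/diffP; apply: (@getPex _ (fun (df : {linear V -> W}) =>
  continuous df /\ forall y, g y = g (lim (nbhs x)) + df (y - lim (nbhs x))
                  +o_(y \near x) (y - lim (nbhs x)))).
exists ('d f x); have /diffP[cf] := df; rewrite lim_id// => ef; split=> //.
move/funext/eqaddoP: ef => ef.
apply/funeqP; apply/eqaddoP => e e0; have := ef e e0.
apply: filter_app; near=> y.
rewrite !fctE.
have <- : f y = g y by near: y.
have <- // : f x = g x by exact: nbhs_singleton fg.
Unshelve. all: by end_near. Qed.
Lemma diff_coord (R : realType) m n (M N : 'M[R]_(m, n)) i j :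
  'd (fun N : 'M[R]_(m, n) => N i j : R ) M N = N i j.
Proof.
have @f : {linear 'M[R]_(m, n) -> R}.
  by exists (fun N : 'M[R]_(_, _) => N i j); do 2![eexists]; do ?[constructor];
     rewrite ?mxE// => ? *; rewrite ?mxE//; move=> ?; rewrite !mxE.
rewrite (_ : (fun _ => _) = f) // diff_lin//; exact/coord_continuous.
Qed.

Lemma cvg_sumr (R : numFieldType) (V : normedModType R) (T I : Type)
    (F : set_system T) (FF : Filter F) (r : seq I) (P : pred I)
    (f : I -> T -> V) (a : I -> V) :
  (forall i, P i -> f i x @[x --> F] --> a i) ->
  \sum_(i <- r | P i) f i x @[x --> F] --> \sum_(i <- r | P i) a i.
Proof. by apply: cvg_big; exact: add_continuous. Qed.

Lemma cvg_mx (R : realType) m n (T : Type) (F : set_system T) (FF : Filter F)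
    (f : T -> 'M[R]_(m, n)) (M : 'M[R]_(m, n)) :
  (forall i j, f x i j @[x --> F] --> M i j) -> f x @[x --> F] --> M.
Proof.
move=> fM; apply/cvgrPdist_le => e e0; near=> x.
rewrite [leLHS]/Num.Def.normr/= mx_normrE (bigmax_le _ (ltW e0))//= => i _.
rewrite !mxE; move: i; near: x; apply: filter_forall => /= i.
by have /cvgrPdist_le/(_ e e0) := fM i.1 i.2.
Unshelve. all: by end_near. Qed.

Lemma mulmxr_continuous (R : realType) m n (B : 'M[R]_(m, n)) :
  continuous (fun w : 'rV[R]_m => w *m B).
Proof.
move=> w; apply: (cvg_mx (F := nbhs w)) => i j; rewrite mxE.
under eq_cvg do rewrite mxE.
apply: (cvg_sumr (F := nbhs w)) => k _; apply: cvgM; last exact: cvg_cst.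
exact: coord_continuous.
Qed.

Section PartialDerivatives.
Variables (R : realType) (n : nat).
Implicit Types (f g : 'rV[R]_n -> R) (U : set 'rV[R]_n).

Lemma diff_partialE f x (v : 'rV[R]_n) : differentiable f x ->
  'd f x v = \sum_i v 0 i * partial i f x.
Proof.
move=> df; rewrite {1}(row_sum_delta v) linear_sum; apply: eq_bigr => i _.
by rewrite linearZ /partial deriveE.
Qed.

Lemma is_derive_curve f (gam : R -> 'rV[R]_n) (t : R) (v : 'rV[R]_n) :
  is_derive t (1 : R) gam v -> differentiable f (gam t) ->
  is_derive t (1 : R) (f \o gam) (\sum_i v 0 i * partial i f (gam t)).
Proof.
move=> [gt gv] df.
have dg : differentiable gam t by apply/derivable1_diffP.
have dfg : differentiable (f \o gam) t by exact: differentiable_comp.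
apply: DeriveDef; first exact/diff_derivable.
rewrite deriveE// diff_comp//= -[X in 'd f _ X](deriveE (1 : R) dg) gv.
exact: diff_partialE.
Qed.

Lemma partial_near f g x i : {near x, f =1 g} -> partial i f x = partial i g x.
Proof. by move=> fg; apply: near_eq_derive. Qed.

Lemma partial_eq_open U f g i : open U -> {in U, f =1 g} ->
  {in U, partial i f =1 partial i g}.
Proof.
move=> oU fg x /set_mem Ux; apply: partial_near.
near=> y; apply: fg; apply/mem_set; near: y; exact: open_nbhs_nbhs.
Unshelve. all: by end_near. Qed.

Lemma partials_eq_open U f g s : open U -> {in U, f =1 g} ->
  {in U, partials s f =1 partials s g}.
Proof.
by move=> oU fg; elim: s => //= i s IH; apply: partial_eq_open.
Qed.

Lemma differentiable_eq_open U f g x : open U -> {in U, f =1 g} -> U x ->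
  differentiable f x -> differentiable g x.
Proof.
move=> oU fg Ux; apply: near_eq_differentiable.
near=> y; apply: fg; apply/mem_set; near: y; exact: open_nbhs_nbhs.
Unshelve. all: by end_near. Qed.

Lemma partialD f g x i : differentiable f x -> differentiable g x ->
  partial i (fun y => f y + g y) x = partial i f x + partial i g x.
Proof. by move=> df dg; rewrite /partial deriveD//; exact: diff_derivable. Qed.

Lemma partialB f g x i : differentiable f x -> differentiable g x ->
  partial i (fun y => f y - g y) x = partial i f x - partial i g x.
Proof. by move=> df dg; rewrite /partial deriveB//; exact: diff_derivable. Qed.

Lemma partialM f g x i : differentiable f x -> differentiable g x ->
  partial i (fun y => f y * g y) x = f x * partial i g x + g x * partial i f x.
Proof. by move=> df dg; rewrite /partial deriveM//; exact: diff_derivable. Qed.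

Lemma partialZ (k : R) f x i : differentiable f x ->
  partial i (fun y => k * f y) x = k * partial i f x.
Proof. by move=> df; rewrite /partial deriveZ//; exact: diff_derivable. Qed.

Lemma partial_sum m (f : 'I_m -> 'rV[R]_n -> R) x i :
  (forall k, differentiable (f k) x) ->
  partial i (fun y => \sum_k f k y) x = \sum_k partial i (f k) x.
Proof.
move=> df; rewrite /partial.
have -> : (fun y => \sum_k f k y) = \sum_k f k.
  by apply/funext => y; rewrite fct_sumE.
by rewrite derive_sum// => k; exact: diff_derivable.
Qed.

Lemma partial_coord (j i : 'I_n) (x : 'rV[R]_n) :
  partial i (fun y => y 0 j) x = (i == j)%:R.
Proof.
rewrite /partial deriveE; last exact: differentiable_coord.
by rewrite diff_coord mxE eqxx eq_sym.
Qed.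

(** One chain rule for two uses: the slice [polar t] of the sphere and the dilation by r are both
    affine in w. *)
Lemma diff_affine_comp m (f : 'rV[R]_n -> R) (a : 'rV[R]_n) (B : 'M[R]_(m, n)) w :
  differentiable f (a + w *m B) ->
  differentiable (fun w => f (a + w *m B)) w /\
  forall j, partial j (fun w => f (a + w *m B)) w =
    \sum_i B j i * partial i f (a + w *m B).
Proof.
move=> df.
have dB : differentiable (mulmxr B : 'rV[R]_m -> _) w.
  by apply: linear_differentiable; exact: mulmxr_continuous.
have da : differentiable (fun w => a + w *m B) w.
  by apply: (differentiableD (f := cst a)).
have dfa : differentiable (fun w => f (a + w *m B)) w.
  exact: (differentiable_comp da df).
split=> // j; rewrite /partial deriveE// (diff_comp da df)/=.
have -> : 'd (fun w => a + w *m B) w (delta_mx 0 j) = row j B.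
  have -> : (fun w => a + w *m B) = cst a + (mulmxr B : 'rV[R]_m -> 'rV[R]_n).
    exact/funext.
  have -> := @diffD R _ _ (cst a) (mulmxr B) w (differentiable_cst _ _) dB.
  have e2 : 'd (mulmxr B : 'rV[R]_m -> 'rV[R]_n) w (delta_mx 0 j) = row j B.
    by rewrite (@diff_lin R _ _ (mulmxr B) w (mulmxr_continuous (B := B))) rowE.
  have e1 : 'd (cst a : 'rV[R]_m -> 'rV[R]_n) w (delta_mx 0 j) = 0.
    by rewrite diff_cst.
  move: e1 e2; case: ('d (cst a) w) => D1 /= ?; case: ('d (mulmxr B) w) => D2 /= ?.
  by move=> e1 e2; rewrite -[RHS]add0r -{1}e1 -e2.
by rewrite diff_partialE//; apply: eq_bigr => i _; rewrite mxE.
Qed.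

End PartialDerivatives.

(** * Euclidean norm and compactness of the unit sphere *)

Section Sphere.
Variable R : realType.

Lemma enorm_ge0 n (x : 'rV[R]_n) : 0 <= enorm x.
Proof. exact: sqrtr_ge0. Qed.

Lemma sqr_enorm n (x : 'rV[R]_n) : enorm x ^+ 2 = \sum_i x 0 i ^+ 2.
Proof. by rewrite sqr_sqrtr// sumr_ge0// => i _; rewrite sqr_ge0. Qed.

Lemma enorm_eq n (x : 'rV[R]_n) (r : R) : 0 <= r ->
  \sum_i x 0 i ^+ 2 = r ^+ 2 -> enorm x = r.
Proof. by move=> r0 e; rewrite /enorm e sqrtr_sqr ger0_norm. Qed.

Lemma enormZ n (k : R) (x : 'rV[R]_n) : enorm (k *: x) = `|k| * enorm x.
Proof.
apply: enorm_eq; first by rewrite mulr_ge0// enorm_ge0.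
rewrite exprMn sqr_enorm real_normK ?num_real// mulr_sumr.
by apply: eq_bigr => i _; rewrite mxE exprMn.
Qed.

Lemma coord_le_enorm n (x : 'rV[R]_n) i : `|x 0 i| <= enorm x.
Proof.
rewrite -(@ler_pXn2r _ 2)// ?nnegrE ?enorm_ge0//.
rewrite sqr_enorm real_normK ?num_real// (bigD1 i)//= lerDl.
by rewrite sumr_ge0// => j _; rewrite sqr_ge0.
Qed.

Lemma continuous_enorm n : continuous (@enorm R n).
Proof.
move=> x; apply: (@continuous_comp _ _ _ (fun x : 'rV[R]_n => \sum_i x 0 i ^+ 2)
  Num.sqrt); last exact: sqrt_continuous.
apply: (cvg_sumr (F := nbhs x)) => i _.
apply: (@continuous_comp _ _ _ (fun x : 'rV[R]_n => x 0 i) (fun y => y ^+ 2)).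
  exact: coord_continuous.
exact: exprn_continuous.
Qed.

Lemma compact_sphere n : compact [set x : 'rV[R]_n | enorm x = 1].
Proof.
apply: bounded_closed_compact.
  exists 1; split=> // M M1 x /= x1; apply/ltW/(le_lt_trans _ M1).
  rewrite [leLHS]/Num.Def.normr/= mx_normrE; apply: bigmax_le => // -[i j] _ /=.
  by rewrite -x1 (ord1 i) coord_le_enorm.
have -> : [set x : 'rV[R]_n | enorm x = 1] = @enorm R n @^-1` [set 1] by [].
by apply: (closed_comp _ (@closed_eq _ _)) => x _; exact: continuous_enorm.
Qed.

(** Tube lemma on the compact sphere. It replaces dominated convergence, both for continuity and for
    differentiation under the sphere integral. *)
Lemma sphere_uniform n (F : R -> 'rV[R]_n -> R) (t0 : R) :
  (forall w, enorm w = 1 -> {for (t0, w), continuous (fun p => F p.1 p.2)}) ->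
  forall e : R, 0 < e ->
    \forall t \near t0, forall w, enorm w = 1 -> `|F t w - F t0 w| <= e.
Proof.
move=> cF e e0.
apply: ((compact_near_coveringP _).1 (@compact_sphere n) R (nbhs t0)
  (fun t w => `|F t w - F t0 w| <= e)) => w /= /cF /cvgrPdist_le.
(* Half of e, because F t' w' and F t0 w' are compared through the common value F t0 w. *)
move=> /(_ (e / 2)) /(_ (divr_gt0 e0 (ltr0Sn _ _)))[/= [A B] [/= At Bw] AB].
have At0 : A t0 by exact: nbhs_singleton At.
exists (B, A) => //= -[w' t'] [/= Bw' At'].
have /= h1 := AB (t', w') (conj At' Bw').
have /= h2 := AB (t0, w') (conj At0 Bw').
rewrite (splitr e) -(subrKA (F t0 w)) (le_trans (ler_normD _ _))// lerD//.
by rewrite distrC.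
Qed.

End Sphere.

(** * The iterated sphere integral *)

Section SphereIntegral.
Variable R : realType.

(** Continuity in all ambient directions, not only along the sphere; slices at a fixed angle inherit
    it by composition with [polar]. *)
Definition sphere_continuous n (f : 'rV[R]_n -> R) :=
  forall w, enorm w = 1 -> {for w, continuous f}.

Definition polar k (t : R) (w : 'rV[R]_k) : 'rV[R]_(1 + k) :=
  row_mx (const_mx (cos t)) (sin t *: w).

Lemma polar_l k t (w : 'rV[R]_k) (i : 'I_1) : polar t w 0 (lshift k i) = cos t.
Proof. by rewrite row_mxEl mxE. Qed.

Lemma polar_r k t (w : 'rV[R]_k) (i : 'I_k) :
  polar t w 0 (rshift 1 i) = sin t * w 0 i.
Proof. by rewrite row_mxEr mxE. Qed.

Lemma polarE k t (w : 'rV[R]_k) :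
  polar t w = row_mx (const_mx (cos t)) 0 + w *m row_mx 0 (sin t)%:M.
Proof. by rewrite mul_mx_row mulmx0 mul_mx_scalar add_row_mx addr0 add0r. Qed.

Lemma enorm_polar k t (w : 'rV[R]_k) : enorm w = 1 -> enorm (polar t w) = 1.
Proof.
move=> w1; apply: enorm_eq => //; rewrite big_split_ord big_ord1/= polar_l.
under eq_bigr do rewrite polar_r exprMn.
by rewrite -mulr_sumr -sqr_enorm w1 expr1n mulr1 cos2Dsin2.
Qed.

Lemma polar_continuous k (t : R) (w : 'rV[R]_k) :
  {for (t, w), continuous (fun p => polar p.1 p.2)}.
Proof.
apply: (cvg_mx (F := nbhs (t, w))) => i j; rewrite (ord1 i).
have [l|r] := split_ordP j => ->.
  under eq_cvg do rewrite polar_l.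
  rewrite polar_l; apply: (cvg_comp fst cos); first exact: cvg_fst.
  exact: continuous_cos.
under eq_cvg do rewrite polar_r.
rewrite polar_r; apply: cvgM.
  apply: (cvg_comp fst sin); first exact: cvg_fst.
  exact: continuous_sin.
apply: (cvg_comp snd (fun w : 'rV[R]_k => w 0 r)); first exact: cvg_snd.
exact: coord_continuous.
Qed.

Lemma sphere_continuous_polar k (f : 'rV[R]_k.+1 -> R) :
  sphere_continuous f -> forall t (w : 'rV[R]_k), enorm w = 1 ->
  {for (t, w), continuous (fun p => f (polar p.1 p.2))}.
Proof.
move=> cf t w w1; apply: (continuous_comp (f := fun p => polar p.1 p.2)).
  exact: polar_continuous.
exact/cf/enorm_polar.
Qed.

Lemma continuous_slice (T U V : topologicalType) (F : T -> U -> V) t u :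
  {for (t, u), continuous (fun p => F p.1 p.2)} -> {for u, continuous (F t)}.
Proof.
move=> cF; apply: (continuous_comp (f := fun u => (t, u))
  (g := fun p => F p.1 p.2)) => //.
by apply: cvg_pair; [exact: cvg_cst|exact: cvg_id].
Qed.

Lemma sphere_continuous_slice k (f : 'rV[R]_k.+1 -> R) t :
  sphere_continuous f -> sphere_continuous (fun w : 'rV[R]_k => f (polar t w)).
Proof.
move=> cf w w1; apply: (continuous_slice (F := fun t w => f (polar t w))).
exact: sphere_continuous_polar.
Qed.

Lemma sphere_integralS k (f : 'rV[R]_k.+2 -> R) :
  sphere_integral f = \int[lebesgue_measure]_(t in `[0, pi])
    (sin t ^+ k * sphere_integral (fun w : 'rV[R]_k.+1 => f (polar t w))).
Proof. by []. Qed.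

Lemma sphere_integral1 (f : 'rV[R]_1 -> R) :
  sphere_integral f = f (const_mx 1) + f (const_mx (-1)).
Proof. by []. Qed.

Lemma enorm_const1 (a : R) : a ^+ 2 = 1 -> enorm (const_mx a : 'rV[R]_1) = 1.
Proof. by move=> a1; apply: enorm_eq => //; rewrite big_ord1 mxE a1 expr1n. Qed.

Lemma eq_sphere_integral k (f g : 'rV[R]_k.+1 -> R) :
  (forall w, enorm w = 1 -> f w = g w) -> sphere_integral f = sphere_integral g.
Proof.
elim: k f g => [|k IH] f g fg.
  by rewrite !sphere_integral1 !fg//; apply: enorm_const1; rewrite ?sqrrN expr1n.
rewrite !sphere_integralS; apply: eq_Rintegral => t _; congr (_ * _).
by apply: IH => w w1; rewrite fg// enorm_polar.
Qed.

Lemma integrable_continuous_itv (f : R -> R) (a b : R) : continuous f ->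
  lebesgue_measure.-integrable `[a, b] (EFin \o f).
Proof.
move=> cf; apply: continuous_compact_integrable; first exact: segment_compact.
exact: continuous_subspaceT.
Qed.

Definition sphere_bounded k := exists2 C : R, 0 <= C &
  forall (f : 'rV[R]_k.+1 -> R) e, sphere_continuous f ->
    (forall w, enorm w = 1 -> `|f w| <= e) -> `|sphere_integral f| <= C * e.

Definition sphere_linear k :=
  forall (f g : 'rV[R]_k.+1 -> R) a, sphere_continuous f -> sphere_continuous g ->
    sphere_integral (fun w => f w + a * g w) =
    sphere_integral f + a * sphere_integral g.

(** By linearity a difference of integrals is the integral of the difference, which is uniformly
    small on the sphere. *)
Lemma sphere_param_continuous k (F : R -> 'rV[R]_k.+1 -> R) :
  sphere_bounded k -> sphere_linear k ->
  (forall t w, enorm w = 1 -> {for (t, w), continuous (fun p => F p.1 p.2)}) ->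
  continuous (fun t => sphere_integral (F t)).
Proof.
move=> [C C0 bd] lin cF t0; apply/cvgrPdist_le => e e0.
(* C is only known to be nonnegative, hence the division by C + 1. *)
have C1 : 0 < C + 1 by rewrite ltr_wpDl.
have := sphere_uniform (cF t0) (divr_gt0 e0 C1).
have cFt t : sphere_continuous (F t).
  by move=> w w1; exact: continuous_slice (cF t w w1).
apply: filter_app; near=> t => Ft.
have -> : sphere_integral (F t0) - sphere_integral (F t) =
          sphere_integral (fun w => F t0 w + (-1) * F t w).
  by rewrite lin// mulN1r.
apply: (le_trans (bd _ (e / (C + 1)) _ _)).
- move=> w w1; apply: (@cvgD _ _ _ (nbhs w)); first exact: cFt.
  by apply: (@cvgM _ _ (nbhs w)); [exact: cvg_cst|exact: cFt].
- by move=> w w1; rewrite mulN1r distrC Ft.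
- by rewrite mulrA ler_pdivrMr// mulrC ler_pM2l// lerDl.
Unshelve. all: by end_near. Qed.

Lemma sphere_integrand_continuous k (f : 'rV[R]_k.+2 -> R) :
  sphere_bounded k -> sphere_linear k -> sphere_continuous f -> continuous (fun t =>
    sin t ^+ k * sphere_integral (fun w : 'rV[R]_k.+1 => f (polar t w))).
Proof.
move=> bd lin cf t; apply: (@cvgM _ _ (nbhs t)).
  apply: (cvg_comp sin (fun x => x ^+ k)); first exact: continuous_sin.
  exact: exprn_continuous.
apply: (sphere_param_continuous (F := fun t w => f (polar t w)) bd lin) => s w.
exact: sphere_continuous_polar.
Qed.

(** The two properties need a joint induction: splitting or bounding the integral over t requires
    integrability, obtained from continuity in t of the inner integral, which itself rests on both
    properties one dimension lower. *)
Lemma sphere_bounded_linear k : sphere_bounded k /\ sphere_linear k.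
Proof.
elim: k => [|k [bd lin]].
  split.
    exists 2 => // f e _ fe; rewrite sphere_integral1 mulr2n mulrDl mul1r.
    rewrite (le_trans (ler_normD _ _))// lerD// fe//; apply: enorm_const1.
      by rewrite expr1n.
    by rewrite sqrrN expr1n.
  by move=> f g a _ _; rewrite !sphere_integral1; ring.
pose phi (f : 'rV[R]_k.+2 -> R) t :=
  sin t ^+ k * sphere_integral (fun w : 'rV[R]_k.+1 => f (polar t w)).
have cphi f : sphere_continuous f -> continuous (phi f).
  exact: sphere_integrand_continuous.
have iphi f (cf : sphere_continuous f) :=
  @integrable_continuous_itv _ 0 pi (cphi f cf).
have mI : measurable (`[0, pi] : set R) by exact: measurable_itv.
split; last first.
  move=> f g a cf cg; rewrite !sphere_integralS -RintegralZl//; last exact: iphi.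
  rewrite -RintegralD//; [|exact: iphi|]; last first.
    apply: (@integrable_continuous_itv (fun t => a * phi g t)) => t.
    by apply: (@cvgM _ _ (nbhs t)); [exact: cvg_cst|exact: cphi].
  apply: eq_Rintegral => t _; rewrite lin; first by ring.
  - exact: sphere_continuous_slice.
  - exact: sphere_continuous_slice.
(* The weight is at most 1 in absolute value and t runs over an interval of length pi. *)
have [C C0 bdC] := bd; exists (C * pi); first by rewrite mulr_ge0// pi_ge0.
move=> f e cf fe; rewrite sphere_integralS.
apply: (le_trans (le_normr_Rintegral _ (iphi f cf))) => //.
apply: (@le_trans _ _ (\int[lebesgue_measure]_(t in `[0, pi]) (C * e))).
  apply: le_Rintegral => //.
  - apply: (@integrable_continuous_itv (fun t => `|phi f t|)) => t.
    exact/(@cvg_norm _ _ _ (nbhs t))/cphi.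
  - by apply: (@integrable_continuous_itv (fun t => C * e)) => t; exact: cvg_cst.
  - move=> t _; rewrite normrM normrX.
    apply: (@le_trans _ _ (1 * (C * e))); last by rewrite mul1r.
    apply: ler_pM => //.
      by rewrite exprn_ile1// ler_norml sin_geN1 sin_le1.
    apply: bdC.
      exact: sphere_continuous_slice.
    by move=> w w1; rewrite fe// enorm_polar.
rewrite Rintegral_cst//= lebesgue_measure_itv/= lte_fin pi_gt0/= subr0.
by rewrite mulrAC.
Qed.

End SphereIntegral.

(** * Algebra of the sphere integral and tangential integration by parts *)

Section Rotation.
Variable R : realType.

Lemma sphere_continuousD n (f g : 'rV[R]_n -> R) : sphere_continuous f ->
  sphere_continuous g -> sphere_continuous (fun w => f w + g w).
Proof.
move=> cf cg w w1; apply: (@cvgD _ _ _ (nbhs w)); [exact: cf|exact: cg].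
Qed.

Lemma sphere_continuousM n (f g : 'rV[R]_n -> R) : sphere_continuous f ->
  sphere_continuous g -> sphere_continuous (fun w => f w * g w).
Proof.
move=> cf cg w w1; apply: (@cvgM _ _ (nbhs w)); [exact: cf|exact: cg].
Qed.

Lemma sphere_continuousN n (f : 'rV[R]_n -> R) : sphere_continuous f ->
  sphere_continuous (fun w => - f w).
Proof. move=> cf w w1; apply: (@cvgN _ _ _ (nbhs w)); exact: cf. Qed.

Lemma sphere_continuous_cst n (a : R) : sphere_continuous (fun w : 'rV[R]_n => a).
Proof. by move=> w w1; exact: cst_continuous. Qed.

Lemma sphere_continuous_coord n i : sphere_continuous (fun w : 'rV[R]_n => w 0 i).
Proof. by move=> w w1; exact: coord_continuous. Qed.

Lemma sphere_continuous_sum n m (f : 'I_m -> 'rV[R]_n -> R) :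
  (forall i, sphere_continuous (f i)) ->
  sphere_continuous (fun w => \sum_i f i w).
Proof. by move=> cf w w1; apply: (cvg_sumr (F := nbhs w)) => i _; exact: cf. Qed.

Hint Resolve sphere_continuousD sphere_continuousM sphere_continuousN
  sphere_continuous_cst sphere_continuous_coord sphere_continuous_sum : sphere.

Lemma sphere_integral_lin k (f g : 'rV[R]_k.+1 -> R) a : sphere_continuous f ->
  sphere_continuous g -> sphere_integral (fun w => f w + a * g w) =
    sphere_integral f + a * sphere_integral g.
Proof. by have [_] := sphere_bounded_linear R k; apply. Qed.

Lemma sphere_integral0 k : sphere_integral (fun w : 'rV[R]_k.+1 => 0) = 0.
Proof.
have /= := @sphere_integral_lin k (fun=> 0) (fun=> 0) (-1)
  (@sphere_continuous_cst _ 0) (@sphere_continuous_cst _ 0).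
by rewrite mulr0 addr0 => ->; rewrite mulN1r subrr.
Qed.

Lemma sphere_integralZ k (f : 'rV[R]_k.+1 -> R) a : sphere_continuous f ->
  sphere_integral (fun w => a * f w) = a * sphere_integral f.
Proof.
move=> cf; rewrite -[RHS]add0r -(sphere_integral0 k) -sphere_integral_lin//.
  by apply: eq_sphere_integral => w _; rewrite add0r.
exact: sphere_continuous_cst.
Qed.

Lemma sphere_integralD k (f g : 'rV[R]_k.+1 -> R) : sphere_continuous f ->
  sphere_continuous g -> sphere_integral (fun w => f w + g w) =
    sphere_integral f + sphere_integral g.
Proof.
move=> cf cg; rewrite -[X in _ + X]mul1r -sphere_integral_lin//.
by apply: eq_sphere_integral => w _; rewrite mul1r.
Qed.

Lemma sphere_integralB k (f g : 'rV[R]_k.+1 -> R) : sphere_continuous f ->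
  sphere_continuous g -> sphere_integral (fun w => f w - g w) =
    sphere_integral f - sphere_integral g.
Proof.
move=> cf cg; rewrite -mulN1r -sphere_integral_lin//.
by apply: eq_sphere_integral => w _; rewrite mulN1r.
Qed.

Lemma sphere_integral_sum k m (f : 'I_m -> 'rV[R]_k.+1 -> R) :
  (forall i, sphere_continuous (f i)) ->
  sphere_integral (fun w => \sum_i f i w) = \sum_i sphere_integral (f i).
Proof.
elim: m f => [|m IH] f cf.
  rewrite big_ord0 -[RHS](sphere_integral0 k).
  by apply: eq_sphere_integral => w _; rewrite big_ord0.
rewrite big_ord_recl -IH// -sphere_integralD//; last exact: sphere_continuous_sum.
by apply: eq_sphere_integral => w _; rewrite big_ord_recl.
Qed.

(** The gradient D is a separate argument, tied to [partial] on the sphere only, so that products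
    and slices carry explicit gradients. *)
Definition sphere_C1 n (f : 'rV[R]_n -> R) (D : 'I_n -> 'rV[R]_n -> R) :=
  forall w, enorm w = 1 -> [/\ differentiable f w,
    forall i, partial i f w = D i w & forall i, {for w, continuous (D i)}].

Lemma sphere_C1_continuous n (f : 'rV[R]_n -> R) D : sphere_C1 f D ->
  sphere_continuous f.
Proof. by move=> fD w /fD[df _ _]; exact: differentiable_continuous. Qed.

Lemma sphere_C1_continuousD n (f : 'rV[R]_n -> R) D i : sphere_C1 f D ->
  sphere_continuous (D i).
Proof. by move=> fD w /fD[_ _]; apply. Qed.

Lemma sphere_C1_coordM n (f : 'rV[R]_n -> R) D m : sphere_C1 f D ->
  sphere_C1 (fun w => w 0 m * f w) (fun i w => w 0 m * D i w + f w * (i == m)%:R).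
Proof.
move=> fD w w1; have [df pf cD] := fD w w1.
have dc := differentiable_coord w 0 m.
split.
- exact: differentiableM.
- by move=> i; rewrite partialM// pf partial_coord.
- move=> i; have : sphere_continuous (fun w => w 0 m * D i w + f w * (i == m)%:R).
    apply: sphere_continuousD; apply: sphere_continuousM.
    + exact: sphere_continuous_coord.
    + exact: sphere_C1_continuousD fD.
    + exact: sphere_C1_continuous fD.
    + exact: sphere_continuous_cst.
  exact.
Qed.

Lemma sum_row_mx0_scalar k (c : R) (j : 'I_k) (F : 'I_(1 + k) -> R) :
  \sum_i row_mx (0 : 'M[R]_(k, 1)) c%:M j i * F i = c * F (rshift 1 j).
Proof.
rewrite big_split_ord big_ord1 row_mxEl mxE mul0r/= add0r.
rewrite (bigD1 j)//= row_mxEr mxE eqxx mulr1n big1 ?addr0// => i ij.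
by rewrite row_mxEr mxE eq_sym (negbTE ij) mul0r.
Qed.

Lemma sphere_C1_slice k (f : 'rV[R]_k.+1 -> R) D t : sphere_C1 f D ->
  sphere_C1 (fun w : 'rV[R]_k => f (polar t w))
    (fun j w => sin t * D (rshift 1 j) (polar t w)).
Proof.
move=> fD w w1; have [df pf cD] := fD _ (enorm_polar t w1).
have E : (fun w : 'rV[R]_k => f (polar t w)) =
  (fun w => f ((row_mx (const_mx (cos t)) 0 : 'rV[R]_(1 + k)) +
    w *m (row_mx 0 (sin t)%:M : 'M[R]_(k, 1 + k)))).
  by apply/funext => v; rewrite polarE.
rewrite E; move: df; rewrite polarE => /diff_affine_comp[dF pF].
split=> //; rewrite -?polarE.
- by move=> j; rewrite pF -polarE -pf; exact: sum_row_mx0_scalar.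
- move=> j; apply: (sphere_continuousM _ _ w1); first exact: sphere_continuous_cst.
  by apply: sphere_continuous_slice; exact: sphere_C1_continuousD fD.
Qed.

(** Set apart as the induction hypothesis on the dimension. *)
Definition rotation_free k := forall (f : 'rV[R]_k.+1 -> R) D, sphere_C1 f D ->
  forall i j, i != j ->
  sphere_integral (fun w => w 0 j * D i w - w 0 i * D j w) = 0.

(* Integration by parts on the sphere: the rotation fields applied to w_m f,
   summed over m, give the j-th component of the tangential gradient. *)
Lemma sphere_tangential k (f : 'rV[R]_k.+1 -> R) D j : rotation_free k ->
  sphere_C1 f D ->
  sphere_integral (D j) =
  sphere_integral (fun w => w 0 j * \sum_m w 0 m * D m w)
  + k%:R * sphere_integral (fun w => w 0 j * f w).
Proof.
move=> rot fD.
have cD i : sphere_continuous (D i) by exact: sphere_C1_continuousD fD.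
have cf : sphere_continuous f by exact: sphere_C1_continuous fD.
(* For m != j, the rotation field applied to w_m f contains a single term without a derivative of f,
   namely w_j f, coming from d_m w_m = 1. *)
have Im m : sphere_integral (fun w => w 0 m * (w 0 m * D j w) - w 0 j * (w 0 m * D m w))
    = (m != j)%:R * sphere_integral (fun w => w 0 j * f w).
  have [->|mj] := eqVneq m j.
    rewrite mul0r -[RHS](sphere_integral0 k).
    by apply: eq_sphere_integral => w _; rewrite subrr.
  have := rot _ _ (sphere_C1_coordM m fD) j m; rewrite eq_sym => /(_ mj).
  rewrite mul1r => /eqP; rewrite -subr_eq0 => /eqP e0.
  apply/eqP; rewrite -subr_eq0 -sphere_integralB; auto 10 with sphere.
  rewrite -e0; apply/eqP; rewrite subr0; apply: eq_sphere_integral => w _.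
  by rewrite eqxx (negbTE mj) mulr1 mulr0 addr0; ring.
(* The factor k, the dimension of the sphere, counts the indices m != j. *)
have -> : k%:R * sphere_integral (fun w => w 0 j * f w) =
    \sum_m (m != j)%:R * sphere_integral (fun w => w 0 j * f w).
  rewrite -mulr_suml; congr (_ * _).
  rewrite -natr_sum -[in RHS]big_mkcond/= sum1_card.
  by rewrite cardC1 card_ord.
under eq_bigr do rewrite -Im.
rewrite -sphere_integral_sum; last by auto 10 with sphere.
rewrite -sphere_integralD; auto 10 with sphere.
apply: eq_sphere_integral => w w1.
rewrite sumrB -mulr_sumr addrC subrK.
under eq_bigr do rewrite mulrA -expr2.
by rewrite -mulr_suml -sqr_enorm w1 expr1n mul1r.
Qed.

End Rotation.

(** * Rotation fields integrate to zero on the sphere *)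

Section RotationFree.
Variable R : realType.

(** Mean value theorem with a and b in either order, as difference quotients have increments of both
    signs. *)
Lemma MVT_sym (f df : R -> R) (a b : R) : (forall t : R, is_derive t (1 : R) f (df t)) ->
  exists c, `|c - a| <= `|b - a| /\ f b - f a = df c * (b - a).
Proof.
move=> fdf.
have cf x y : {within `[x, y], continuous f}.
  apply: continuous_subspaceT => t; apply: differentiable_continuous.
  exact/derivable1_diffP.
have [ab|/ltW ba] := leP a b.
  have [c cab e] := MVT_segment ab (fun t _ => fdf t) (cf _ _).
  exists c; split=> //; move: cab; rewrite in_itv/= => /andP[ac cb].
  by rewrite !ger0_norm ?subr_ge0// lerD2r.
have [c cab e] := MVT_segment ba (fun t _ => fdf t) (cf _ _).
exists c; split; last by rewrite -opprB e -mulrN opprB.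
move: cab; rewrite in_itv/= => /andP[ac cb].
by rewrite !ler0_norm ?subr_le0// lerN2 lerD2r.
Qed.

(** The mean value theorem turns the difference quotient at w into dF at an intermediate time, and
    [sphere_uniform] makes the resulting error small for all w at once. *)
Lemma sphere_integral_derive k (F dF : R -> 'rV[R]_k.+1 -> R) (t0 : R) :
  (forall t, sphere_continuous (F t)) -> (forall t, sphere_continuous (dF t)) ->
  (forall w, enorm w = 1 -> {for (t0, w), continuous (fun p => dF p.1 p.2)}) ->
  (forall (t : R) w, enorm w = 1 -> is_derive t (1 : R) (F ^~ w) (dF t w)) ->
  is_derive t0 (1 : R) (fun t => sphere_integral (F t)) (sphere_integral (dF t0)).
Proof.
move=> cF cdF jdF der.
suff H : h^-1 *: (((fun t => sphere_integral (F t)) \o shift t0) (h *: 1)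
    - sphere_integral (F t0)) @[h --> 0^'] --> sphere_integral (dF t0).
  by apply: DeriveDef; [apply/cvg_ex; eexists; exact: H|exact: cvg_lim H].
have [[C C0 bd] _] := sphere_bounded_linear R k.
apply/cvgrPdist_le => e e0.
have C1 : 0 < C + 1 by rewrite ltr_wpDl.
have /nbhs_ballP[/= d d0 Hd] := sphere_uniform jdF (divr_gt0 e0 C1).
near=> h.
have h0 : h != 0 by near: h; exact: nbhs_dnbhs_neq.
have hd : `|h| < d by near: h; exact: dnbhs0_lt.
rewrite /= /GRing.scale/= mulr1.
have -> : sphere_integral (dF t0) - h^-1 * (sphere_integral (F (h + t0)) -
    sphere_integral (F t0)) =
    sphere_integral (fun w => dF t0 w + (- h^-1) * (F (h + t0) w + (-1) * F t0 w)).
  rewrite sphere_integral_lin//.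
    by rewrite sphere_integral_lin//; ring.
  apply: sphere_continuousD; first exact: cF.
  by apply: sphere_continuousM; [exact: sphere_continuous_cst|exact: cF].
apply: (le_trans (bd _ (e / (C + 1)) _ _)).
- apply: sphere_continuousD; first exact: cdF.
  apply: sphere_continuousM; first exact: sphere_continuous_cst.
  apply: sphere_continuousD; first exact: cF.
  by apply: sphere_continuousM; [exact: sphere_continuous_cst|exact: cF].
- move=> w w1.
  (* The time c depends on w, but its distance to t0 is at most |h| < d for every w. *)
  have [c [ca ec]] := MVT_sym t0 (h + t0) (fun t => der t w w1).
  rewrite mulN1r ec addrK mulrCA mulNr mulVf// mulrN1 distrC Hd//.
  by rewrite /ball/= distrC (le_lt_trans ca)// addrK.
- by rewrite mulrA ler_pdivrMr// mulrC ler_pM2l// lerDl.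
Unshelve. all: by end_near. Qed.

Lemma is_derive_polar k (t : R) (w : 'rV[R]_k) :
  is_derive t (1 : R) (fun t => polar t w) (row_mx (const_mx (- sin t)) (cos t *: w)).
Proof.
have H i j : is_derive t (1 : R) (fun t => polar t w i j)
    (row_mx (const_mx (- sin t)) (cos t *: w) i j).
  rewrite (ord1 i); have [l|r] := split_ordP j => ->.
    under eq_fun do rewrite polar_l.
    by rewrite row_mxEl mxE; exact: is_derive_cos.
  under eq_fun do rewrite polar_r.
  rewrite row_mxEr mxE.
  have := @is_deriveM _ _ sin (cst (w 0 r)) t 1 _ _ (is_derive_sin t)
    (is_derive_cst (w 0 r) t 1).
  by have -> : sin t *: 0 + cst (w 0 r) t *: cos t = cos t * w 0 r
    by rewrite scaler0 add0r mulrC.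
have D : derivable (fun t => polar t w) t 1.
  by apply/derivable_mxP => i j; have [] := H i j.
apply: DeriveDef => //; rewrite derive_mx//; apply/matrixP => i j; rewrite mxE.
by have [_ ->] := H i j.
Qed.

Lemma is_derive_slice k (f : 'rV[R]_k.+1 -> R) D (s : R) (w : 'rV[R]_k) :
  sphere_C1 f D -> enorm w = 1 ->
  is_derive s (1 : R) (fun s => f (polar s w))
    (- sin s * D (@lshift 1 k ord0) (polar s w) +
     cos s * \sum_m w 0 m * D (rshift 1 m) (polar s w)).
Proof.
move=> fD w1; have [df pf _] := fD _ (enorm_polar s w1).
have := is_derive_curve (is_derive_polar s w) df.
rewrite (@big_split_ord _ _ _ 1 k) big_ord1/=.
rewrite {1}(row_mxEl (const_mx (- sin s))) mxE pf mulr_sumr.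
under eq_bigr do rewrite (row_mxEr (const_mx (- sin s))) mxE pf -mulrA.
exact.
Qed.

(** Such a rotation preserves each slice; the factor sin t in the coordinates is exactly the one in
    the gradient of the slice, so the inner integral is already zero. *)
Lemma rotation_free_rr k (f : 'rV[R]_k.+2 -> R) D (i j : 'I_k.+1) :
  rotation_free R k -> sphere_C1 f D -> i != j ->
  sphere_integral (fun w : 'rV[R]_(1 + k.+1) => w 0 (rshift 1 j) * D (rshift 1 i) w
    - w 0 (rshift 1 i) * D (rshift 1 j) w) = 0.
Proof.
move=> rot fD ij; rewrite sphere_integralS.
transitivity (\int[lebesgue_measure]_(t in `[0, pi]) (0 : R)); last first.
  by rewrite Rintegral_cst ?mul0r.
apply: eq_Rintegral => t _; rewrite -(mulr0 (sin t ^+ k)); congr (_ * _).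
rewrite -[RHS](rot _ _ (sphere_C1_slice t fD) i j ij).
by apply: eq_sphere_integral => w _; rewrite !polar_r; ring.
Qed.

(** Serves the circle, where sin t ^+ 0 = 1 does not kill the boundary terms at the poles; oddness
    of the coordinate on two points does. *)
Lemma sphere_integral_coord0 k (j : 'I_k.+1) (a : R) : k = 0 ->
  sphere_integral (fun w : 'rV[R]_k.+1 => w 0 j * a) = 0.
Proof. by move=> k0; subst k; rewrite sphere_integral1 !mxE; ring. Qed.

(** This rotation changes the angle t, so the zero comes from the outer integral: the integrand
    [psi] is the derivative of - sin t ^+ k * Phi t. Differentiating [Phi] yields the axial term [a]
    and the radial term [c] of the slice, and [sphere_tangential] on the slice trades [c] for the
    component [b] that occurs in [psi]. *)
Lemma rotation_free_lr k (f : 'rV[R]_k.+2 -> R) D (j : 'I_k.+1) :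
  rotation_free R k -> sphere_C1 f D ->
  sphere_integral (fun w : 'rV[R]_(1 + k.+1) =>
    w 0 (rshift 1 j) * D (@lshift 1 k.+1 ord0) w
    - w 0 (@lshift 1 k.+1 ord0) * D (rshift 1 j) w) = 0.
Proof.
move=> rot fD; set l := @lshift 1 k.+1 ord0; pose r := @rshift 1 k.+1.
have cf : sphere_continuous f by exact: sphere_C1_continuous fD.
have cD i : sphere_continuous (D i) by exact: sphere_C1_continuousD fD.
pose a t := sphere_integral (fun w : 'rV[R]_k.+1 => w 0 j * D l (polar t w)).
pose b t := sphere_integral (fun w : 'rV[R]_k.+1 => D (r j) (polar t w)).
pose c t := sphere_integral (fun w : 'rV[R]_k.+1 =>
  w 0 j * \sum_m w 0 m * D (r m) (polar t w)).
pose Phi t := sphere_integral (fun w : 'rV[R]_k.+1 => w 0 j * f (polar t w)).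
pose dF t (w : 'rV[R]_k.+1) := w 0 j * (- sin t * D l (polar t w) +
  cos t * \sum_m w 0 m * D (r m) (polar t w)).
have cP i t : sphere_continuous (fun w : 'rV[R]_k.+1 => D i (polar t w)).
  exact: sphere_continuous_slice.
have cfP t : sphere_continuous (fun w : 'rV[R]_k.+1 => f (polar t w)).
  exact: sphere_continuous_slice.
have ca t : sphere_continuous (fun w : 'rV[R]_k.+1 => w 0 j * D l (polar t w)).
  by apply: sphere_continuousM; [exact: sphere_continuous_coord|exact: cP].
have cS t : sphere_continuous (fun w : 'rV[R]_k.+1 =>
    \sum_m w 0 m * D (r m) (polar t w)).
  apply: sphere_continuous_sum => m.
  by apply: sphere_continuousM; [exact: sphere_continuous_coord|exact: cP].
have cc t : sphere_continuous (fun w : 'rV[R]_k.+1 =>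
    w 0 j * \sum_m w 0 m * D (r m) (polar t w)).
  by apply: sphere_continuousM; [exact: sphere_continuous_coord|exact: cS].
have IdF t : sphere_integral (dF t) = - sin t * a t + cos t * c t.
  rewrite /a -(sphere_integralZ (- sin t) (ca t)) -sphere_integral_lin//; last first.
    by apply: sphere_continuousM => //; exact: sphere_continuous_cst.
  by apply: eq_sphere_integral => w _; rewrite /dF; ring.
(* The tangential identity on the slice carries a factor sin t on both gradient terms; it is
   multiplied by sin t ^+ k.-1. For k = 0 that factor would have to be divided out, so b = c is
   shown directly from w_j^2 = 1 on two points. *)
have bc t : sin t ^+ k * b t = sin t ^+ k * c t + k%:R * sin t ^+ k.-1 * Phi t.
  have := sphere_tangential j rot (sphere_C1_slice t fD).
  rewrite -/(Phi t) sphere_integralZ; last exact: cP.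
  rewrite -/(b t) (_ : sphere_integral _ = sin t * c t); last first.
    rewrite -sphere_integralZ//; apply: eq_sphere_integral => w _.
    rewrite [RHS]mulrCA; congr (_ * _); rewrite mulr_sumr.
    by apply: eq_bigr => m _; rewrite mulrCA.
  have bc0 : k = 0 -> b t = c t.
    move=> k0; have Ij (m : 'I_k.+1) : m = j.
      have lt1 (i : 'I_k.+1) : (i < 1)%N by rewrite (leq_trans (ltn_ord i))// k0.
      by apply: val_inj => /=; case: (val m) (lt1 m) (val j) (lt1 j) => [|?] // _ [].
    have sumI (F : 'I_k.+1 -> R) : \sum_m F m = F j.
      by rewrite (bigD1 j)//= big1 ?addr0// => m; rewrite (Ij m) eqxx.
    apply: eq_sphere_integral => w w1.
    have := sqr_enorm w; rewrite w1 expr1n !sumI => w2.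
    by rewrite mulrA -expr2 -w2 mul1r.
  case: (posnP k) => [k0 _|k0 e].
    by rewrite bc0// k0 mul0r mul0r addr0.
  by rewrite -(prednK k0) !exprSr -!mulrA e (prednK k0)/= mulrDr; congr (_ + _); ring.
have dPhi t : is_derive t (1 : R) Phi (- sin t * a t + cos t * c t).
  rewrite -IdF; apply: (sphere_integral_derive
    (F := fun t (w : 'rV[R]_k.+1) => w 0 j * f (polar t w))).
  - by move=> s; apply: sphere_continuousM; [exact: sphere_continuous_coord|exact: cfP].
  - move=> s; apply: sphere_continuousM; first exact: sphere_continuous_coord.
    apply: sphere_continuousD; apply: sphere_continuousM => //;
      exact: sphere_continuous_cst.
  - move=> w w1.
    have jD i : {for (t, w), continuous (fun p => D i (polar p.1 p.2))}.
      by apply: sphere_continuous_polar.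
    have jw m : {for (t, w), continuous (fun p : R * 'rV[R]_k.+1 => p.2 0 m)}.
      apply: (cvg_comp snd (fun w : 'rV[R]_k.+1 => w 0 m)); first exact: cvg_snd.
      exact: coord_continuous.
    apply: (@cvgM _ _ (nbhs (t, w))); first exact: jw.
    apply: (@cvgD _ _ _ (nbhs (t, w))); apply: (@cvgM _ _ (nbhs (t, w))).
    + apply: (@cvgN _ _ _ (nbhs (t, w))).
      by apply: (cvg_comp fst sin); [exact: cvg_fst|exact: continuous_sin].
    + exact: jD.
    + by apply: (cvg_comp fst cos); [exact: cvg_fst|exact: continuous_cos].
    + apply: (cvg_sumr (F := nbhs (t, w))) => m _.
      by apply: (@cvgM _ _ (nbhs (t, w))); [exact: jw|exact: jD].
  - move=> s w w1.
    have := @is_deriveZ _ _ _ (fun s => f (polar s w)) (w 0 j) s 1 _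
      (is_derive_slice s fD w1).
    exact.
pose psi t := sin t ^+ k * sphere_integral (fun w : 'rV[R]_k.+1 =>
  polar t w 0 (r j) * D l (polar t w) - polar t w 0 l * D (r j) (polar t w)).
have psiE t : psi t = sin t ^+ k * (sin t * a t - cos t * b t).
  rewrite /psi; congr (_ * _).
  have cb : sphere_continuous (fun w : 'rV[R]_k.+1 => D (r j) (polar t w)) by [].
  rewrite -(sphere_integralZ (sin t) (ca t)) -mulNr -sphere_integral_lin//; last first.
    by apply: sphere_continuousM => //; exact: sphere_continuous_cst.
  by apply: eq_sphere_integral => w _; rewrite polar_r polar_l; ring.
have dG t : is_derive t (1 : R) (fun t => - (sin t ^+ k * Phi t)) (psi t).
  have -> : (fun t => - (sin t ^+ k * Phi t)) = - (sin ^+ k * Phi).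
    by apply/funext => s; rewrite !fctE.
  apply: (is_derive_eq (is_deriveN (is_deriveM (is_deriveX k (is_derive_sin t)) (dPhi t)))).
  rewrite psiE exprfctE /GRing.scale/=.
  have := bc t; move: (a t) (b t) (c t) (Phi t) (sin t ^+ k) => at' bt ct Pt sk e.
  ring: e.
have cpsi : continuous psi.
  have [bd lin] := sphere_bounded_linear R k.
  apply: (@sphere_integrand_continuous _ _ (fun w => w 0 (r j) * D l w - w 0 l * D (r j) w)) => //.
  apply: sphere_continuousD; last apply: sphere_continuousN; apply: sphere_continuousM => //;
    exact: sphere_continuous_coord.
(* At a pole the power of sin vanishes if k > 0; if k = 0, f is constant on the slice and the
   coordinate is odd. *)
have end0 t : sin t = 0 -> sin t ^+ k * Phi t = 0.
  move=> s0; case: (posnP k) => [k0|k0]; last by rewrite s0 expr0n gtn_eqF// mul0r.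
  rewrite [Phi t](_ : _ = 0) ?mulr0// -(sphere_integral_coord0 j (f (polar t 0)) k0).
  by apply: eq_sphere_integral => w _; rewrite /polar s0 !scale0r.
have cG : continuous (fun t => - (sin t ^+ k * Phi t)).
  by move=> t; apply/differentiable_continuous/derivable1_diffP; have [] := dG t.
rewrite sphere_integralS /Rintegral.
rewrite (continuous_FTC2 (F := fun t => - (sin t ^+ k * Phi t)) (pi_gt0 R)).
- by rewrite !end0 ?sin0 ?sinpi// oppr0 -EFinB subrr.
- exact: continuous_subspaceT cpsi.
- split; first by move=> t _; have [] := dG t.
    exact/cvg_at_right_filter/cG.
  exact/cvg_at_left_filter/cG.
- by move=> t _; rewrite derive1E; have [_ ->] := dG t.
Qed.

Lemma sphere_integral_rotation k (f : 'rV[R]_k.+1 -> R) D i j :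
  sphere_C1 f D -> i != j ->
  sphere_integral (fun w => w 0 j * D i w - w 0 i * D j w) = 0.
Proof.
elim: k f D i j => [|k IH] f D i j fD; first by rewrite (ord1 i) (ord1 j) eqxx.
have rot : rotation_free R k by move=> g E gE i' j'; exact: (IH g E i' j' gE).
have [i'|i'] := @split_ordP 1 k.+1 i => ->; have [j'|j'] := @split_ordP 1 k.+1 j => ->.
- by rewrite (ord1 i') (ord1 j') eqxx.
- have -> : i' = ord0 by exact: ord1.
  by move=> _; exact: (rotation_free_lr j' rot fD).
- have -> : j' = ord0 by exact: ord1.
  move=> _; rewrite -[RHS]oppr0 -(rotation_free_lr i' rot fD).
  rewrite -mulN1r -sphere_integralZ.
    by apply: eq_sphere_integral => w _; ring.
  apply: sphere_continuousD; last apply: sphere_continuousN; apply: sphere_continuousM;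
    try exact: sphere_continuous_coord; exact: sphere_C1_continuousD fD.
- move=> ij; apply: (rotation_free_rr rot fD); apply/eqP => e.
  by move: ij; rewrite e eqxx.
Qed.

End RotationFree.

(** * Charts at infinity *)

Section Smooth.
Variables (R : realType) (n : nat).
Implicit Types (U : set 'rV[R]_n) (f : 'rV[R]_n -> R).

Lemma smooth_onS U V f : U `<=` V -> smooth_on V f -> smooth_on U f.
Proof. by move=> UV fV s x /UV; exact: fV. Qed.

Lemma smooth_on_eq U f g : open U -> {in U, f =1 g} -> smooth_on U f ->
  smooth_on U g.
Proof.
move=> oU fg fU s x Ux; apply: (differentiable_eq_open oU _ Ux (fU s x Ux)).
exact: partials_eq_open.
Qed.

Lemma partials_lin U m (a : 'I_m -> R) (f : 'I_m -> 'rV[R]_n -> R) s : open U ->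
  (forall i, smooth_on U (f i)) ->
  {in U, partials s (fun x => \sum_i a i * f i x) =1
         fun x => \sum_i a i * partials s (f i) x}.
Proof.
move=> oU fU; elim: s => [|k s IH] //= x xU.
rewrite (partial_eq_open k oU IH xU) partial_sum => [|i].
  apply: eq_bigr => i _; rewrite partialZ//; apply: fU; exact: set_mem.
by apply: differentiableZ; apply: fU; exact: set_mem.
Qed.

(** Applied to a local lift followed by a group element, whose coordinates are linear combinations
    of those of the lift. *)
Lemma smooth_on_lin U m (a : 'I_m -> R) (f : 'I_m -> 'rV[R]_n -> R) : open U ->
  (forall i, smooth_on U (f i)) -> smooth_on U (fun x => \sum_i a i * f i x).
Proof.
move=> oU fU s x Ux.
have e := partials_lin a s oU fU.
apply: (differentiable_eq_open oU (f := fun x => \sum_i a i * partials s (f i) x)) => //.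
  by move=> y yU; rewrite e.
have -> : (fun x => \sum_i a i * partials s (f i) x) =
    \sum_i (a i *: partials s (f i)).
  by apply/funext => y; rewrite fct_sumE.
by apply: differentiable_sum => i; apply: differentiableZ; exact: fU.
Qed.

End Smooth.

Section LocalGeometry.
Variables (R : realType) (n : nat).
Implicit Types (U : set 'rV[R]_n) (G : 'rV[R]_n -> 'M[R]_n).

Lemma ricci_eq_open U G G' : open U -> {in U, G =1 G'} ->
  {in U, ricci G =1 ricci G'}.
Proof.
move=> oU GG'.
have Gij i j : {in U, (fun y => G y i j) =1 (fun y => G' y i j)}.
  by move=> y yU; rewrite GG'.
have cE k i j : {in U, christoffel G k i j =1 christoffel G' k i j}.
  move=> y yU; rewrite /christoffel /ginv GG'//; congr (_ * _).
  by apply: eq_bigr => l _; rewrite !(partial_eq_open _ oU (Gij _ _) yU).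
have RE l i j k : {in U, curv G l i j k =1 curv G' l i j k}.
  move=> y yU; rewrite /curv !(partial_eq_open _ oU (cE _ _ _) yU); congr (_ + _).
  by apply: eq_bigr => m _; rewrite !cE.
move=> y yU; apply/matrixP => j l; rewrite !mxE.
by apply: eq_bigr => i _; rewrite RE.
Qed.

Lemma open_chart_image (M : manifold R n) (d : chart R n M) (W : set M) :
  atlas d -> open W -> open (cmap d @` (W `&` cdom d)).
Proof.
move=> /atlas_chart[od oi dK _ ci] oW.
rewrite openE => x [q [Wq dq] <-].
have idq : cimg d (cmap d q) by exists q.
near=> y.
have [q' dq' qy] : cimg d y by near: y; exact: open_nbhs_nbhs.
exists q' => //; split=> //; rewrite -(dK q')// qy.
near: y; apply: (ci _ idq); rewrite dK//; exact: open_nbhs_nbhs.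
Unshelve. all: by end_near. Qed.

Lemma chart_atP (M : manifold R n) (p : M) : atlas (chart_at p) /\ cdom (chart_at p) p.
Proof. exact: svalP (cid (atlas_cover p)). Qed.

End LocalGeometry.

Section ALEChart.
Variables (R : realType) (n : nat) (M : manifold R n) (g : metric M) (tau : R).
Variable E : ALE g tau.
Local Notation F := (ale_map E).
Local Notation Out := (outside (ale_radius E)).

Lemma open_outside r : open (outside r : set 'rV[R]_n).
Proof.
apply: (open_comp (f := @enorm R n) (D := [set t | r < t])).
  by move=> x _; exact: continuous_enorm.
exact: open_gt.
Qed.

Lemma enorm_orth (s : 'M[R]_n) (x : 'rV[R]_n) : s *m s^T = 1%:M ->
  enorm (x *m s) = enorm x.
Proof.
have sq (y : 'rV[R]_n) : \sum_i y 0 i ^+ 2 = (y *m y^T) 0 0.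
  by rewrite mxE; apply: eq_bigr => i _; rewrite mxE expr2.
by move=> ss; rewrite /enorm !sq trmx_mul mulmxA -(mulmxA x) ss mulmx1.
Qed.

Lemma ale_group_free_outside s x : s \in ale_group E -> 0 < enorm x ->
  x *m s = x -> s = 1%:M.
Proof.
move=> sG x0 xs; apply: (ale_group_free (x := (enorm x)^-1 *: x)) sG _ _.
  by rewrite enormZ ger0_norm ?invr_ge0 ?enorm_ge0// mulVf ?gt_eqF.
by rewrite -scalemxAl xs.
Qed.

Lemma ale_lift_continuous (W : set M) (sig : M -> 'rV[R]_n) q : open W ->
  (forall c, atlas c -> smooth_map_on (cmap c @` (W `&` cdom c)) (sig \o cinv c)) ->
  W q -> {for q, continuous sig}.
Proof.
move=> oW sm Wq; have [ad dq] := chart_atP q; set d := chart_at q in ad dq.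
have [od _ dK cd _] := atlas_chart ad.
apply: (cvg_mx (F := nbhs q)) => i j; rewrite (ord1 i).
have c1 : {for cmap d q, continuous (fun x => (sig \o cinv d) x 0 j)}.
  apply: differentiable_continuous; apply: (sm d ad j [::]).
  by exists q.
have c2 : ((fun x => (sig \o cinv d) x 0 j) \o cmap d) q' @[q' --> q] -->
    (sig \o cinv d) (cmap d q) 0 j.
  exact: (continuous_comp (cd q dq) c1).
move: c2; rewrite /= dK//; apply: cvg_trans; apply: near_eq_cvg.
near=> y => /=; rewrite dK//; near: y; exact: open_nbhs_nbhs.
Unshelve. all: by end_near. Qed.

(* A local inverse of the ALE map is a chart of the maximal atlas, and in it the
   components of g are those of the pullback: statements about all charts
   transfer to the pullback with no change of variables. *)
Lemma ale_chart x0 : Out x0 -> exists c : chart R n M,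
  [/\ atlas c, cimg c x0 & forall x, cimg c x -> Out x /\ pullback g F x = g c x].
Proof.
move=> ox0; have [W [sig [oW Wp sigP smsig]]] := ale_lift (@ale_map_core _ _ _ _ _ E x0 ox0).
have [osp Fsp] := sigP _ Wp.
have [s sG x0E] := (ale_map_fibre osp ox0).1 Fsp.
have ss := ale_group_orth sG.
(* The given lift may send F x0 to another point of the orbit of x0; the group element s corrects
   this. *)
pose sg q := sig q *m s.
have sgp : sg (F x0) = x0 by rewrite /sg -x0E.
have sgO q : W q -> Out (sg q).
  by move=> /sigP[oq _]; rewrite /outside/= enorm_orth.
have Fsg q : W q -> F (sg q) = q.
  move=> Wq; have [oq Fq] := sigP q Wq; rewrite -[RHS]Fq; apply/esym.
  by apply/(ale_map_fibre oq (sgO q Wq)); exists s.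
have csg q : W q -> {for q, continuous sg}.
  move=> Wq; apply: (@continuous_comp _ _ _ sig (fun x : 'rV[R]_n => x *m s) q).
    exact: ale_lift_continuous smsig Wq.
  exact: mulmxr_continuous.
have cF x : Out x -> {for x, continuous F} by exact: ale_map_continuous.
have nearW : \forall x \near x0, W (F x).
  by apply: (cF x0 ox0); exact: open_nbhs_nbhs.
have near1 : \forall x \near x0, sg (F x) = x.
  have csgF : {for x0, continuous (sg \o F)}.
    by apply: continuous_comp; [exact: cF|exact: csg].
  (* Since x and sg (F x) lie in one fibre, sg (F x) = x t for some t depending on x. Freeness
     excludes t != 1 at x0, continuity excludes it near x0, and finiteness of the group gives one
     neighbourhood for all t. *)
  have sep (t : ale_group E) : \forall x \near x0, val t != 1%:M -> sg (F x) != x *m val t.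
    have [->|t1] := eqVneq (val t) 1%:M; first by near=> x.
    have : sg (F x0) - x0 *m val t != 0.
      rewrite sgp subr_eq0; apply: contra t1 => /eqP e; apply/eqP.
      apply: (ale_group_free_outside (valP t) _ (esym e)).
      exact: lt_trans (ale_radius_gt0 E) ox0.
    rewrite -normr_gt0 => pos.
    have : `|sg (F x) - x *m val t| @[x --> x0] --> `|sg (F x0) - x0 *m val t|.
      apply: (@cvg_norm _ _ _ (nbhs x0)); apply: (@cvgB _ _ _ (nbhs x0)) => //.
      exact: mulmxr_continuous.
    move=> /cvgr_gt /(_ _ pos) H.
    near=> x => _; rewrite -subr_eq0 -normr_gt0; near: x; exact: H.
  near=> x.
  have ox : Out x by near: x; apply: open_nbhs_nbhs; split=> //; exact: open_outside.
  have Wx : W (F x) by near: x.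
  have /(ale_map_fibre ox (sgO _ Wx))[t tG xt] : F x = F (sg (F x)) by rewrite Fsg.
  have : forall t : ale_group E, val t != 1%:M -> sg (F x) != x *m val t.
    by near: x; exact: filter_forall.
  move=> /(_ (FSetSub tG))/=; rewrite xt eqxx; have [->|_ /(_ isT)//] := eqVneq t 1%:M.
  by rewrite mulmx1.
pose A := [set x | [/\ Out x, W (F x) & sg (F x) = x]].
have Ax0 : A° x0.
  near=> x; split.
  - by near: x; apply: open_nbhs_nbhs; split=> //; exact: open_outside.
  - by near: x.
  - by near: x.
have sA x : A° x -> A x by exact: interior_subset.
(* Passing to the interior of A makes the image of the chart exactly that open set. *)
pose c := Chart (W `&` sg @^-1` A°) sg F.
have cimgE : cimg c = A°.
  apply/seteqP; split=> [_ [q [_ ?] <-]//|x Ax]; have [_ Wx sx] := sA x Ax.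
  by exists (F x); rewrite /= ?sx//; split=> //; rewrite /= sx.
have cc : is_chart c.
  split.
  - rewrite openE => q [Wq Aq]; apply: filterI; first exact: open_nbhs_nbhs.
    by apply: (csg q Wq); apply: open_nbhs_nbhs; split=> //; exact: open_interior.
  - by rewrite cimgE; exact: open_interior.
  - by move=> p [Wq _]; exact: Fsg.
  - by move=> p [Wq _]; exact: csg.
  - by rewrite cimgE => x /sA[ox _ _]; exact: cF.
have ac : atlas c.
  (* The transition from c to d is smooth because the ALE map is, the one from d to c because the
     lift is. *)
  apply: atlas_max => // d ad; split.
    move=> k; have sub : cmap c @` (cdom c `&` cdom d) `<=`
        [set x | Out x /\ cdom d (F x)].
      by move=> _ [q [[Wq _] dq] <-]; rewrite /= Fsg//; split=> //; exact: sgO.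

    exact: (smooth_onS sub (@ale_map_smooth _ _ _ _ _ E d ad k)).
  move=> k; have sub : cmap d @` (cdom d `&` cdom c) `<=` cmap d @` (W `&` cdom d).
    by move=> _ [q [dq [Wq _]] <-]; exists q.
  apply: (smooth_onS sub).
  have -> : (fun x => (cmap c \o cinv d) x 0 k) =
      (fun x => \sum_i s i k * (sig \o cinv d) x 0 i).
    by apply/funext => x; rewrite /= mxE; apply: eq_bigr => i _; rewrite mulrC.
  apply: smooth_on_lin; first exact: open_chart_image.
  by move=> i; exact: (smsig d ad i).
exists c; split=> //; first by rewrite cimgE.
move=> x cx; move: (cx); rewrite cimgE => /sA[ox Wx sx]; split=> //.
have [ad dq] := chart_atP (F x).
have cdx : cdom c (F x) by split=> //; rewrite /= sx -cimgE.
(* Since [cinv c] is F and sg (F x) = x, this transformation law is literally the definition of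
   [pullback]. *)
have := comp_transform g ac ad cdx dq.
by rewrite /= sx => ->.
Unshelve. all: by end_near. Qed.

End ALEChart.

(** * Symmetry of second derivatives and derivatives of the inverse matrix *)

Section Schwarz.
Variables (R : realType) (n : nat).
Implicit Types (f : 'rV[R]_n -> R) (x y : 'rV[R]_n).

Lemma is_derive_line f y i (s : R) : differentiable f (y + s *: delta_mx 0 i) ->
  is_derive s (1 : R) (fun s => f (y + s *: delta_mx 0 i))
    (partial i f (y + s *: delta_mx 0 i)).
Proof.
move=> df.
have dg : is_derive s (1 : R) (fun s : R => y + s *: (delta_mx 0 i : 'rV[R]_n)) (delta_mx 0 i).
  have H : is_diff s (fun s : R => y + s *: (delta_mx 0 i : 'rV[R]_n))
      (0 + *:%R ^~ (delta_mx 0 i : 'rV[R]_n)).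
    exact: (@is_diffD _ _ _ (cst y)).
  apply: DeriveDef; first by apply: diff_derivable; case: H.
  rewrite deriveE; last by case: H.
  by have [_ ->] := H; rewrite -[LHS]/(0 + 1 *: _) add0r scale1r.
have := is_derive_curve dg df.
rewrite (bigD1 i)//= mxE !eqxx mul1r big1 ?addr0// => j ji.
by rewrite mxE (negbTE ji) andbF mul0r.
Qed.

Lemma norm_delta_le1 (i : 'I_n) : `|delta_mx 0 i : 'rV[R]_n| <= 1.
Proof.
rewrite [leLHS]/Num.Def.normr/= mx_normrE; apply: bigmax_le => // -[j k] _ /=.
by rewrite mxE; case: (_ && _); rewrite ?normr1 ?normr0.
Qed.

Lemma norm_corner_lt x i j (s t h r : R) : 0 <= s <= h -> 0 <= t <= h -> h + h < r ->
  `|x - (x + s *: delta_mx 0 i + t *: delta_mx 0 j)| < r.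
Proof.
move=> /andP[s0 sh] /andP[t0 th]; apply: le_lt_trans.
rewrite -addrA opprD addrA subrr sub0r normrN (le_trans (ler_normD _ _))//.
rewrite !normrZ !ger0_norm//; apply: lerD.
  by rewrite -[leRHS]mulr1; apply: ler_pM => //; exact: norm_delta_le1.
by rewrite -[leRHS]mulr1; apply: ler_pM => //; exact: norm_delta_le1.
Qed.

(** Mean value theorem in direction i for the increment of f by h e_j, then in direction j for
    [partial i f]. The left-hand side is symmetric in i and j. *)
Lemma second_difference f x i j (r h : R) : 0 < h -> h + h < r ->
  (forall y, `|x - y| < r -> differentiable f y /\ differentiable (partial i f) y) ->
  exists s t, [/\ 0 <= s <= h, 0 <= t <= h &
    f (x + h *: delta_mx 0 i + h *: delta_mx 0 j) - f (x + h *: delta_mx 0 i)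
    - (f (x + h *: delta_mx 0 j) - f x) =
    partial j (partial i f) (x + s *: delta_mx 0 i + t *: delta_mx 0 j) * h * h].
Proof.
move=> h0 hr df.
have near s t : 0 <= s <= h -> 0 <= t <= h ->
    `|x - (x + s *: delta_mx 0 i + t *: delta_mx 0 j)| < r.
  by move=> ps pt; exact: norm_corner_lt hr.
pose y t s := x + t *: delta_mx 0 j + s *: (delta_mx 0 i : 'rV[R]_n).
have yE t s : y t s = x + s *: delta_mx 0 i + t *: delta_mx 0 j.
  by rewrite /y addrAC.
have hh : 0 <= h <= h by rewrite lexx ltW.
have h00 : 0 <= (0 : R) <= h by rewrite lexx ltW.
have dF t s : 0 <= s <= h -> 0 <= t <= h ->
    is_derive s (1 : R) (fun s => f (y t s)) (partial i f (y t s)).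
  move=> ps pt; apply: (@is_derive_line f (x + t *: delta_mx 0 j) i s).
  by apply: (df _ _).1; rewrite addrAC near.
have dP s : 0 <= s <= h ->
    is_derive s (1 : R) (fun s => f (y h s) - f (y 0 s))
      (partial i f (y h s) - partial i f (y 0 s)).
  by move=> ps; apply: is_deriveB; exact: dF.
have [s sh es] : exists2 s, s \in `[0, h] & f (y h h) - f (y 0 h) - (f (y h 0) - f (y 0 0))
     = (partial i f (y h s) - partial i f (y 0 s)) * (h - 0).
  apply: (MVT_segment (f := fun s => f (y h s) - f (y 0 s))
     (df := fun s => partial i f (y h s) - partial i f (y 0 s))); first exact: ltW.
    by move=> s; rewrite in_itv/= => /andP[s0 s1]; apply: dP; rewrite !ltW.
  apply: derivable_within_continuous => s; rewrite in_itv/= => ps.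
  by have [] := dP s ps.
rewrite in_itv/= in sh.
have dQ t : 0 <= t <= h -> is_derive t (1 : R)
    (fun t => partial i f (x + s *: delta_mx 0 i + t *: delta_mx 0 j))
    (partial j (partial i f) (x + s *: delta_mx 0 i + t *: delta_mx 0 j)).
  by move=> pt; apply: is_derive_line; apply: (df _ _).2; exact: near.
have [t th et] : exists2 t, t \in `[0, h] & 
    partial i f (x + s *: delta_mx 0 i + h *: delta_mx 0 j)
    - partial i f (x + s *: delta_mx 0 i + 0 *: delta_mx 0 j) =
    partial j (partial i f) (x + s *: delta_mx 0 i + t *: delta_mx 0 j) * (h - 0).
  apply: (MVT_segment (f := fun t => partial i f (x + s *: delta_mx 0 i + t *: delta_mx 0 j))
    (df := fun t => partial j (partial i f) (x + s *: delta_mx 0 i + t *: delta_mx 0 j)));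
    first exact: ltW.
    by move=> t; rewrite in_itv/= => /andP[t0 t1]; apply: dQ; rewrite !ltW.
  apply: derivable_within_continuous => t; rewrite in_itv/= => pt.
  by have [] := dQ t pt.
rewrite in_itv/= in th.
exists s, t; split=> //; rewrite subr0 in et; rewrite -et.
by move: es; rewrite !yE !scale0r !addr0 subr0.
Qed.

(** One second difference equals h^2 times either mixed derivative, each at some point near x;
    continuity of both closes the gap up to any e. *)
Lemma partialC U f x i j : open U -> smooth_on U f -> U x ->
  partial i (partial j f) x = partial j (partial i f) x.
Proof.
move=> oU fU Ux; apply/eqP; rewrite -subr_eq0 -normr_le0; apply/ler_addgt0Pl => e e0.
rewrite addr0.
have cont a b : {for x, continuous (partial a (partial b f))}.
  by apply: differentiable_continuous; apply: (fU [:: a; b]).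
have e20 : 0 < e / 2 by rewrite divr_gt0.
have : \forall y \near x, [/\ U y,
   `|partial i (partial j f) x - partial i (partial j f) y| <= e / 2 &
   `|partial j (partial i f) x - partial j (partial i f) y| <= e / 2].
  have nU : nbhs x U by exact: open_nbhs_nbhs.
  have /cvgrPdist_le/(_ _ e20) n1 := cont i j.
  have /cvgrPdist_le/(_ _ e20) n2 := cont j i.
  by move: (partial i _) (partial j _) n1 n2 => P Q n1 n2; apply: filterS3 nU n1 n2.
move=> /nbhs_ballP[r/= r0 Hr].
have Hb y : `|x - y| < r -> [/\ U y,
   `|partial i (partial j f) x - partial i (partial j f) y| <= e / 2 &
   `|partial j (partial i f) x - partial j (partial i f) y| <= e / 2].
  by move=> xy; apply: Hr; rewrite -ball_normE.
have h0 : 0 < r / 3 by rewrite divr_gt0.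
have hr : r / 3 + r / 3 < r by lra.
have [|s [t [sh th E1]]] := @second_difference f x i j r _ h0 hr.
  by move=> y /Hb[Uy _ _]; split; [exact: (fU [::])|exact: (fU [:: i])].
have [|s' [t' [sh' th' E2]]] := @second_difference f x j i r _ h0 hr.
  by move=> y /Hb[Uy _ _]; split; [exact: (fU [::])|exact: (fU [:: j])].
have [_ _ B1] := Hb _ (norm_corner_lt x i j sh th hr).
have [_ B2 _] := Hb _ (norm_corner_lt x j i sh' th' hr).
have hn0 : r / 3 != 0 by rewrite gt_eqF.
have XY (X Y A B C D : R) : A - B - (C - D) = X * (r / 3) * (r / 3) ->
    A - C - (B - D) = Y * (r / 3) * (r / 3) -> X = Y.
  move=> eX eY; apply: (mulIf hn0); apply: (mulIf hn0); rewrite -eX -eY; ring.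
rewrite (addrAC x ((r / 3) *: delta_mx 0 j)) in E2.
have {}XY := XY _ _ _ _ _ _ E1 E2.
rewrite XY in B1; rewrite distrC in B1.
apply: (le_trans (ler_distD _ _ _)) (le_trans (lerD B2 B1) _).
by rewrite -splitr.
Qed.

End Schwarz.

Section Invmx.
Variables (R : realType) (n : nat).

Lemma differentiable_bigsum (I : Type) (r : seq I) (P : pred I)
    (f : I -> 'rV[R]_n -> R) x :
  (forall i, P i -> differentiable (f i) x) ->
  differentiable (fun y => \sum_(i <- r | P i) f i y) x.
Proof.
move=> df; elim: r => [|i r IH].
  by under eq_fun do rewrite big_nil; exact: differentiable_cst.
under eq_fun do rewrite big_cons.
by case: (P i) (df i) => // dfi; apply: differentiableD => //; exact: dfi.
Qed.

Lemma differentiable_bigprod (I : Type) (r : seq I) (P : pred I)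
    (f : I -> 'rV[R]_n -> R) x :
  (forall i, P i -> differentiable (f i) x) ->
  differentiable (fun y => \prod_(i <- r | P i) f i y) x.
Proof.
move=> df; elim: r => [|i r IH].
  by under eq_fun do rewrite big_nil; exact: differentiable_cst.
under eq_fun do rewrite big_cons.
by case: (P i) (df i) => // dfi; apply: differentiableM => //; exact: dfi.
Qed.

Lemma differentiable_det m (A : 'rV[R]_n -> 'M[R]_m) x :
  (forall i j, differentiable (fun y => A y i j) x) ->
  differentiable (fun y => \det (A y)) x.
Proof.
move=> dA; apply: differentiable_bigsum => s _; apply: differentiableM.
  exact: differentiable_cst.
by apply: differentiable_bigprod => i _; exact: dA.
Qed.

(** Cramer's rule. Invertibility is asked on an open set because [invmx] agrees with that formula
    only on invertible matrices. *)
Lemma differentiable_invmx m (U : set 'rV[R]_n) (A : 'rV[R]_n -> 'M[R]_m) x i j :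
  open U -> (forall y, U y -> A y \in unitmx) -> U x ->
  (forall i j, differentiable (fun y => A y i j) x) ->
  differentiable (fun y => invmx (A y) i j) x.
Proof.
move=> oU uA Ux dA.
apply: (differentiable_eq_open oU (f := fun y => (\det (A y))^-1 * cofactor (A y) j i)) => //.
  by move=> y /set_mem/uA uy; rewrite /invmx uy !mxE.
apply: differentiableM.
  apply: differentiableV; first exact: differentiable_det.
  by have := uA x Ux; rewrite unitmxE unitfE.
apply: differentiableM; first exact: differentiable_cst.
apply: differentiable_det => a b.
by under eq_fun do rewrite !mxE; exact: dA.
Qed.

End Invmx.

(** * Decay at infinity *)

Section BigO.
Variables (R : realType) (n : nat).
Implicit Types (f g : 'rV[R]_n -> R) (a b : R).

(** With K nonnegative and r0 at least 1, bounds can be multiplied and a larger exponent gives a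
    weaker bound. *)
Lemma big_OP f a : is_big_O f a <-> exists K r0, [/\ 0 <= K, 1 <= r0 &
  forall x, r0 <= enorm x -> `|f x| <= K * enorm x `^ a].
Proof.
split=> [[K [r0 [r00 H]]]|[K [r0 [K0 r01 H]]]]; last first.
  by exists K, r0; split=> //; exact: lt_le_trans r01.
exists `|K|, (Num.max 1 r0); split=> //; first by rewrite le_max lexx.
move=> x; rewrite ge_max => /andP[_ /H] /le_trans; apply.
by apply: ler_wpM2r; [exact: powR_ge0|exact: ler_norm].
Qed.

Lemma big_OD f g a : is_big_O f a -> is_big_O g a -> is_big_O (fun x => f x + g x) a.
Proof.
move=> /big_OP[K [r [K0 r1 H]]] /big_OP[L [s [L0 s1 H']]]; apply/big_OP.
exists (K + L), (Num.max r s); split; [exact: addr_ge0|by rewrite le_max r1|].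
move=> x; rewrite ge_max => /andP[/H h /H' h'].
by rewrite mulrDl (le_trans (ler_normD _ _))// lerD.
Qed.

Lemma big_OM f g a b : is_big_O f a -> is_big_O g b ->
  is_big_O (fun x => f x * g x) (a + b).
Proof.
move=> /big_OP[K [r [K0 r1 H]]] /big_OP[L [s [L0 s1 H']]]; apply/big_OP.
exists (K * L), (Num.max r s); split; [exact: mulr_ge0|by rewrite le_max r1|].
move=> x; rewrite ge_max => /andP[rx sx].
have x0 : enorm x != 0 by rewrite gt_eqF// (lt_le_trans _ rx)// (lt_le_trans _ r1).
rewrite normrM powRD ?x0 ?implybT// mulrACA.
by apply: ler_pM => //; [exact: H|exact: H'].
Qed.

Lemma big_OZ f a (k : R) : is_big_O f a -> is_big_O (fun x => k * f x) a.
Proof.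
move=> /big_OP[K [r [K0 r1 H]]]; apply/big_OP; exists (`|k| * K), r; split=> //.
  exact: mulr_ge0.
by move=> x /H h; rewrite normrM -mulrA ler_wpM2l.
Qed.

Lemma big_ON f a : is_big_O f a -> is_big_O (fun x => - f x) a.
Proof. by move=> /(big_OZ (-1)); under eq_fun do rewrite mulN1r. Qed.

Lemma big_OB f g a : is_big_O f a -> is_big_O g a -> is_big_O (fun x => f x - g x) a.
Proof. by move=> Hf /big_ON; exact: big_OD. Qed.

Lemma big_O0 a : is_big_O (fun _ : 'rV[R]_n => 0) a.
Proof.
apply/big_OP; exists 0, 1; split=> // x _; by rewrite normr0 mul0r.
Qed.

Lemma big_O_sum m (f : 'I_m -> 'rV[R]_n -> R) a : (forall i, is_big_O (f i) a) ->
  is_big_O (fun x => \sum_i f i x) a.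
Proof.
elim: m f => [|m IH] f Hf.
  by under eq_fun do rewrite big_ord0; exact: big_O0.
by under eq_fun do rewrite big_ord_recl; apply: big_OD => //; apply: IH => i.
Qed.

Lemma big_O_eq f g a r : (forall x, outside r x -> f x = g x) -> is_big_O f a ->
  is_big_O g a.
Proof.
move=> fg /big_OP[K [s [K0 s1 H]]]; apply/big_OP; exists K, (Num.max s (r + 1)).
split=> //; first by rewrite le_max s1.
move=> x; rewrite ge_max => /andP[sx rx]; rewrite -fg; first exact: H.
by apply: lt_le_trans rx; rewrite ltrDl.
Qed.

Lemma big_OW f a b : a <= b -> is_big_O f a -> is_big_O f b.
Proof.
move=> ab /big_OP[K [r [K0 r1 H]]]; apply/big_OP; exists K, r; split=> // x rx.
apply: (le_trans (H x rx)); apply: ler_wpM2l => //.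
by apply: ler_powR => //; exact: le_trans rx.
Qed.

Lemma big_O1 (k : R) : is_big_O (fun _ : 'rV[R]_n => k) 0.
Proof.
apply/big_OP; exists `|k|, 1; split=> // x x1.
by rewrite powRr0 mulr1.
Qed.

Lemma powR_small a (e : R) : a < 0 -> 0 < e ->
  exists2 s, 0 < s & forall r, s <= r -> r `^ a <= e.
Proof.
(* The witness solves s^a = e. *)
move=> a0 e0; exists (e `^ a^-1); first exact: powR_gt0.
move=> r sr; have s0 : 0 < e `^ a^-1 by exact: powR_gt0.
have r0 : 0 < r := lt_le_trans s0 sr.
have : (e `^ a^-1) `^ (- a) <= r `^ (- a).
  by apply: ge0_ler_powR => //; rewrite ?nnegrE ?oppr_ge0 ltW.
rewrite !powRN lef_pV2 ?posrE ?powR_gt0//.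
by rewrite -powRrM mulVf ?lt_eqF// powRr1 ?(ltW e0).
Qed.

Lemma big_O_small f a (e : R) : a < 0 -> 0 < e -> is_big_O f a ->
  exists2 r, 0 < r & forall x, r <= enorm x -> `|f x| <= e.
Proof.
move=> a0 e0 /big_OP[K [r [K0 r1 H]]].
have K1 : 0 < K + 1 by rewrite ltr_wpDl.
have [s s0 Hs] := powR_small a0 (divr_gt0 e0 K1).
exists (Num.max r s); first by rewrite lt_max (lt_le_trans ltr01 r1).
move=> x; rewrite ge_max => /andP[/H Hx /Hs sx]; apply: (le_trans Hx).
apply: (le_trans (ler_wpM2l K0 sx)).
by rewrite mulrA ler_pdivrMr// mulrC ler_pM2l// lerDl.
Qed.

End BigO.

(** * Sup norm of matrices and inverses near the identity *)

Section MatrixNorm.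
Variable R : realType.

Lemma coord_le_mxnorm m n (A : 'M[R]_(m, n)) i j : `|A i j| <= `|A|.
Proof.
rewrite [leRHS]/Num.Def.normr/= mx_normrE.
exact: (le_bigmax _ (fun ij => `|A ij.1 ij.2|) (i, j)).
Qed.

Lemma mxnorm_le m n (A : 'M[R]_(m, n)) (e : R) : 0 <= e ->
  (forall i j, `|A i j| <= e) -> `|A| <= e.
Proof.
move=> e0 Ae; rewrite [leLHS]/Num.Def.normr/= mx_normrE.
by apply: bigmax_le => // -[i j] _; exact: Ae.
Qed.

Lemma mxnorm_mul m n p (A : 'M[R]_(m, n)) (B : 'M[R]_(n, p)) :
  `|A *m B| <= n%:R * `|A| * `|B|.
Proof.
apply: mxnorm_le => [|i j]; first by rewrite !mulr_ge0.
rewrite mxE (le_trans (ler_norm_sum _ _ _))//.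
apply: (@le_trans _ _ (\sum_(k < n) `|A| * `|B|)).
  by apply: ler_sum => k _; rewrite normrM ler_pM// coord_le_mxnorm.
by rewrite sumr_const card_ord -mulrA mulr_natl.
Qed.

(** With B = A - 1, the identity A^-1 - 1 = - B - B (A^-1 - 1) gives N <= |B| + N / 2, and N / 2 is
    absorbed. The factor n is that of [mxnorm_mul]. *)
Lemma mxnorm_invmx_sub1 n (A : 'M[R]_n) : A \in unitmx ->
  n%:R * `|A - 1%:M| <= 2^-1 -> `|invmx A - 1%:M| <= 2 * `|A - 1%:M|.
Proof.
move=> uA small; set N := `|invmx A - _|.
have e : invmx A - 1%:M = - (A - 1%:M) - (A - 1%:M) *m (invmx A - 1%:M).
  rewrite mulmxBr mulmx1 mulmxBl mulmxV// mul1mx.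
  by rewrite [X in _ = _ + X]opprB addrA addNr add0r opprB.
have : N <= `|A - 1%:M| + 2^-1 * N.
  rewrite {1}/N e (le_trans (ler_normB _ _))// normrN lerD2l.
  by rewrite (le_trans (mxnorm_mul _ _))// ler_wpM2r.
move: N `|A - _| => N a; lra.
Qed.

End MatrixNorm.

(** * Expansion of the Ricci tensor around the flat metric *)

Section RicciExpansion.
Variables (R : realType) (n : nat) (G : 'rV[R]_n -> 'M[R]_n) (R0 tau : R).
Local Notation U := (@outside R n R0).
Local Notation g i j := (fun y => G y i j).
Local Notation H := (ginv G).
Hypotheses (tau0 : 0 < tau)
  (smG : forall i j, smooth_on U (g i j))
  (symG : forall x, U x -> (G x)^T = G x)
  (uG : forall x, U x -> G x \in unitmx)
  (ricG : forall x, U x -> ricci G x = 0)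
  (decG : forall s i j, is_big_O (partials s (fun x => G x i j - (i == j)%:R))
    (- tau - (size s)%:R)).

Let oU : open U. Proof. exact: open_outside. Qed.

(** The difference quotients coincide, so this is an equality of functions and rewrites under
    further derivatives. *)
Lemma partial_subc k (f : 'rV[R]_n -> R) c :
  partial k (fun x => f x - c) = partial k f.
Proof.
apply/funext => x; rewrite /partial /derive.
rewrite (_ : (fun h : R => _) =
  (fun h : R => h^-1 *: ((f \o shift x) (h *: delta_mx 0 k) - f x)))//.
by apply/funext => t /=; rewrite opprB addrA subrK.
Qed.

Lemma metric_decay i j : is_big_O (fun x => G x i j - (i == j)%:R) (- tau).
Proof. by have := decG [::] i j; rewrite subr0. Qed.

Lemma metric_decay1 k i j : is_big_O (partial k (g i j)) (- tau - 1).
Proof. by have := decG [:: k] i j; rewrite /= partial_subc. Qed.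

Lemma metric_decay2 k l i j :
  is_big_O (partial k (partial l (g i j))) (- tau - 2).
Proof. by have := decG [:: k; l] i j; rewrite /= partial_subc. Qed.

Lemma big_O_le (f h : 'rV[R]_n -> R) a r :
  (forall x, r <= enorm x -> `|f x| <= h x) -> is_big_O h a -> is_big_O f a.
Proof.
move=> fh /big_OP[K [s [K0 s1 Hh]]]; apply/big_OP; exists K, (Num.max s r).
split=> //; first by rewrite le_max s1.
move=> x; rewrite ge_max => /andP[sx rx].
by rewrite (le_trans (fh x rx))// (le_trans (ler_norm _))// Hh.
Qed.

Lemma metric_sub1_decay : is_big_O (fun x => `|G x - 1%:M|) (- tau).
Proof.
apply: (@big_O_le _ (fun x => \sum_i \sum_j `|G x i j - (i == j)%:R|) _ 0).
  move=> x _; rewrite normr_id; apply: mxnorm_le => [|i j].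
    by apply: sumr_ge0 => i _; apply: sumr_ge0.
  rewrite !mxE (bigD1 i)//= (bigD1 j)//= -addrA lerDl.
  by apply: addr_ge0; apply: sumr_ge0 => // k _; apply: sumr_ge0.
apply: big_O_sum => i; apply: big_O_sum => j.
have /big_OP[K [r [K0 r1 Hr]]] := metric_decay i j.
by apply/big_OP; exists K, r; split=> // x; rewrite normr_id; exact: Hr.
Qed.

Lemma ginv_decay i j : is_big_O (fun x => H x i j - (i == j)%:R) (- tau).
Proof.
have n1 : 0 < (n%:R + 1 : R) by rewrite ltr_wpDl.
have ta : - tau < 0 by rewrite oppr_lt0.
have e0 : 0 < 2^-1 / (n%:R + 1 : R) by rewrite divr_gt0.
(* Beyond r, n |G - 1| <= 1/2 as [mxnorm_invmx_sub1] asks; the divisor n + 1 is positive for every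
   n. *)
have [r r0 small] := big_O_small ta e0 metric_sub1_decay.
apply: (@big_O_le _ (fun x => 2 * `|G x - 1%:M|) _ (Num.max r (R0 + 1))).
  move=> x; rewrite ge_max => /andP[/small]; rewrite normr_id => sx Rx.
  have Ux : U x by apply: lt_le_trans Rx; rewrite ltrDl.
  apply: le_trans (mxnorm_invmx_sub1 (uG Ux) _).
    have := coord_le_mxnorm (H x - 1%:M) i j; rewrite !mxE//.
  rewrite (le_trans _ (_ : (n%:R + 1) * `|G x - 1%:M| <= _))//.
    by rewrite ler_wpM2r// lerDl.
  by rewrite mulrC -ler_pdivlMr.
exact: big_OZ metric_sub1_decay.
Qed.

Lemma ginv_bounded i j : is_big_O (fun x => H x i j) 0.
Proof.
have t0 : - tau <= 0 by rewrite oppr_le0 ltW.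
have := big_OD (big_OW t0 (ginv_decay i j)) (big_O1 n (i == j)%:R).
by under eq_fun do rewrite subrK.
Qed.

Lemma differentiable_ginv i j x : U x -> differentiable (fun y => H y i j) x.
Proof.
move=> Ux; apply: (differentiable_invmx _ _ oU uG Ux) => a b.
exact: (@smG _ _ [::] x Ux).
Qed.

(** Obtained by differentiating G H = 1 on U. *)
Lemma partial_ginv k i j x : U x -> partial k (fun y => H y i j) x =
  - \sum_a \sum_b H x i a * partial k (g a b) x * H x b j.
Proof.
move=> Ux.
pose dG : 'M[R]_n := \matrix_(a, b) partial k (g a b) x.
pose dH : 'M[R]_n := \matrix_(a, b) partial k (fun y => H y a b) x.
have dGx a b : differentiable (g a b) x by exact: (@smG _ _ [::] x Ux).
have e0 : G x *m dH + dG *m H x = 0.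
  apply/matrixP => a b; rewrite !mxE -big_split/=.
  transitivity (partial k (fun y => \sum_c G y a c * H y c b) x).
    rewrite partial_sum => [|c]; last first.
      by apply: differentiableM; [exact: dGx|exact: differentiable_ginv].
    apply: eq_bigr => c _; rewrite partialM//; last exact: differentiable_ginv.
    by rewrite !mxE; congr (_ + _); rewrite mulrC.
  rewrite (partial_eq_open k oU (g := cst ((a == b)%:R))) ?inE//.
    by rewrite /partial derive_cst.
  move=> y /set_mem Uy; have := mulmxV (uG Uy).
  by move=> /matrixP/(_ a b); rewrite !mxE.
have dHE : dH = - (H x *m dG *m H x).
  apply/eqP; rewrite -addr_eq0 -mulmxA; apply/eqP.
  by rewrite -{1}[dH]mul1mx -(mulVmx (uG Ux)) -mulmxA -mulmxDr e0 mulmx0.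
have := congr1 (fun A : 'M[R]_n => A i j) dHE; rewrite !mxE => ->; congr (- _).
rewrite exchange_big/=; apply: eq_bigr => b _; rewrite !mxE mulr_suml.
by apply: eq_bigr => a _; rewrite !mxE.
Qed.

Lemma ginv_decay1 k i j : is_big_O (partial k (fun y => H y i j)) (- tau - 1).
Proof.
apply: (@big_O_eq _ _ (fun x => - \sum_a \sum_b H x i a * partial k (g a b) x * H x b j)
  _ _ R0).
  by move=> x Ux; rewrite partial_ginv.
apply/big_ON/big_O_sum => a; apply: big_O_sum => b.
rewrite -[- tau - 1]addr0 -[X in X + _]add0r; apply: big_OM; last exact: ginv_bounded.
by apply: big_OM; [exact: ginv_bounded|exact: metric_decay1].
Qed.

(** Twice the Christoffel symbol of the first kind. *)
Definition christoffel1 (i j l : 'I_n) x : R :=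
  partial i (g j l) x + partial j (g i l) x - partial l (g i j) x.

Lemma differentiable_christoffel1 i j l x : U x -> differentiable (christoffel1 i j l) x.
Proof.
move=> Ux.
by apply: differentiableB; first apply: differentiableD; exact: (@smG _ _ [:: _] x Ux).
Qed.

Lemma christoffel1_decay i j l : is_big_O (christoffel1 i j l) (- tau - 1).
Proof.
by apply: big_OB; first apply: big_OD; exact: metric_decay1.
Qed.

Lemma partial_christoffel1 p i j l x : U x -> partial p (christoffel1 i j l) x =
  partial p (partial i (g j l)) x + partial p (partial j (g i l)) x
  - partial p (partial l (g i j)) x.
Proof.
move=> Ux; have d a b c : differentiable (partial a (g b c)) x by exact: (@smG _ _ [:: _] x Ux).
rewrite partialB//; last exact: differentiableD.
by rewrite partialD.
Qed.

Lemma christoffel1_decay1 p i j l :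
  is_big_O (partial p (christoffel1 i j l)) (- tau - 2).
Proof.
apply: (big_O_eq (r := R0) (fun x Ux => esym (partial_christoffel1 p i j l Ux))).
by apply: big_OB; first apply: big_OD; exact: metric_decay2.
Qed.

Lemma christoffel_decay k i j : is_big_O (christoffel G k i j) (- tau - 1).
Proof.
apply: big_OZ; apply: big_O_sum => l; rewrite -[- tau - 1]add0r.
by apply: big_OM; [exact: ginv_bounded|exact: christoffel1_decay].
Qed.

(** Replacing H by the identity leaves (H - 1) times second derivatives of g, and dH times first
    derivatives. Both products have order - 2 tau - 2. *)
Lemma partial_christoffel_decay p k i j : is_big_O (fun x =>
  partial p (christoffel G k i j) x - 2^-1 * partial p (christoffel1 i j k) x)
  (- (2 * tau) - 2).
Proof.
apply: (@big_O_eq _ _ (fun x => 2^-1 * \sum_l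
    ((H x k l - (k == l)%:R) * partial p (christoffel1 i j l) x +
     christoffel1 i j l x * partial p (fun y => H y k l) x)) _ _ R0); last first.
  apply: big_OZ; apply: big_O_sum => l; apply: big_OD.
    have -> : - (2 * tau) - 2 = - tau + (- tau - 2) by ring.
    by apply: big_OM; [exact: ginv_decay|exact: christoffel1_decay1].
  have -> : - (2 * tau) - 2 = (- tau - 1) + (- tau - 1) by ring.
  by apply: big_OM; [exact: christoffel1_decay|exact: ginv_decay1].
move=> x Ux.
have dl l : differentiable (fun y => H y k l * christoffel1 i j l y) x.
  by apply: differentiableM; [exact: differentiable_ginv|exact: differentiable_christoffel1].
rewrite [in RHS]partialZ; last exact: differentiable_bigsum.
rewrite partial_sum// -mulrBr; congr (_ * _).
have -> : partial p (christoffel1 i j k) x =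
    \sum_l (k == l)%:R * partial p (christoffel1 i j l) x.
  rewrite (bigD1 k)//= eqxx mul1r big1 ?addr0// => l lk.
  by rewrite eq_sym (negbTE lk) mul0r.
rewrite -sumrB; apply: eq_bigr => l _.
rewrite [X in _ = X - _](_ : _ = H x k l * partial p (christoffel1 i j l) x +
  christoffel1 i j l x * partial p (fun y => H y k l) x); first by ring.
by apply: partialM; [exact: differentiable_ginv|exact: differentiable_christoffel1].
Qed.

(** The tensor P: [ricci] without its products of Christoffel symbols, and with the inverse metric
    replaced by delta. *)
Definition linear_ricci (j l : 'I_n) x : R :=
  \sum_i (2^-1 * partial i (christoffel1 j l i) x
          - 2^-1 * partial j (christoffel1 i l i) x).

Lemma linear_ricci_decay j l : is_big_O (linear_ricci j l) (- (2 * tau) - 2).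
Proof.
pose q i x := \sum_m (christoffel G i i m x * christoffel G m j l x
            - christoffel G i j m x * christoffel G m i l x).
(* Subtracting the vanishing Ricci tensor from P leaves only errors of quadratic order. *)
apply: (@big_O_eq _ _ (fun x => - \sum_i
  ((partial i (christoffel G i j l) x - 2^-1 * partial i (christoffel1 j l i) x)
   - (partial j (christoffel G i i l) x - 2^-1 * partial j (christoffel1 i l i) x)
   + q i x)) _ _ R0).
  move=> x Ux; have /matrixP/(_ j l) := ricG Ux; rewrite !mxE => r0.
  apply: (@etrans _ _ (linear_ricci j l x - \sum_i curv G i i j l x)); last first.
    by rewrite r0 subr0.
  rewrite /linear_ricci -sumrB -sumrN; apply: eq_bigr => i _.
  have alg (a b c d e : R) : - (a - c - (b - d) + e) = c - d - (a - b + e) by ring.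
  exact: alg.
apply/big_ON/big_O_sum => i; apply: big_OD.
  by apply: big_OB; exact: partial_christoffel_decay.
apply: big_O_sum => m.
have -> : - (2 * tau) - 2 = (- tau - 1) + (- tau - 1) by ring.
by apply: big_OB; apply: big_OM; exact: christoffel_decay.
Qed.

End RicciExpansion.

(** * The linearized Einstein tensor as a divergence *)

Local Opaque partial.

Section MassIdentity.
Variables (R : realType) (n : nat) (G : 'rV[R]_n -> 'M[R]_n) (R0 : R).
Local Notation U := (@outside R n R0).
Local Notation g i j := (fun y => G y i j).
Hypotheses (smG : forall i j, smooth_on U (g i j))
  (symG : forall x, U x -> (G x)^T = G x).

Let oU : open U. Proof. exact: open_outside. Qed.

Definition mass_field (j : 'I_n) x : R :=
  \sum_m (partial m (g m j) x - partial j (g m m) x).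

(** The tensor K, with [mass_field] as U. In its divergence over i, the term in delta_il gives d_l
    U_j / 2 and completes the second derivatives of e to P_jl; the term in delta_jl gives - delta_jl
    S / 2, since S is the divergence of U. *)
Definition superpotential (i j l : 'I_n) x : R :=
  2^-1 * (partial j (g i l) x - partial i (g j l) x
          + (i == l)%:R * mass_field j x - (j == l)%:R * mass_field i x).

Definition radial_potential (i j : 'I_n) (x : 'rV[R]_n) : R :=
  \sum_l x 0 l * superpotential i j l x.

Lemma radial_potentialC i j x : radial_potential j i x = - radial_potential i j x.
Proof.
rewrite /radial_potential -sumrN; apply: eq_bigr => l _; rewrite -mulrN -mulrN.
have alg (a b c d : R) : a - b + c - d = - (b - a + d - c) by ring.
by congr (_ * (_ * _)); exact: alg.
Qed.

Let d1 k i j x : U x -> differentiable (partial k (g i j)) x.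
Proof. by move=> Ux; exact: (@smG _ _ [:: k] x Ux). Qed.

Let d2 k l i j x : U x -> differentiable (partial k (partial l (g i j))) x.
Proof. by move=> Ux; exact: (@smG _ _ [:: k; l] x Ux). Qed.

Let gC i j : {in U, g i j =1 g j i}.
Proof.
by move=> x /set_mem/symG /matrixP/(_ i j); rewrite mxE => ->.
Qed.

Let p1C k i j x : U x -> partial k (g i j) x = partial k (g j i) x.
Proof. by move=> Ux; apply: (partial_eq_open k oU (gC i j)); exact/mem_set. Qed.

Let p2C k l i j x : U x ->
  partial k (partial l (g i j)) x = partial k (partial l (g j i)) x.
Proof.
move=> Ux; apply: (partials_eq_open [:: k; l] oU (gC i j)); exact/mem_set.
Qed.

Let p2S k l i j x : U x ->
  partial k (partial l (g i j)) x = partial l (partial k (g i j)) x.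
Proof. by move=> Ux; apply: (partialC _ _ oU (@smG i j) Ux). Qed.

Lemma differentiable_mass_field j x : U x -> differentiable (mass_field j) x.
Proof.
by move=> Ux; apply: differentiable_bigsum => m _; apply: differentiableB; exact: d1.
Qed.

(** Explicit derivatives, here and in [dsuperpotential]: they reduce the identities to algebra in
    second derivatives of g, and are visibly differentiable again. *)
Definition dmass_field (p j : 'I_n) x : R :=
  \sum_m (partial p (partial m (g m j)) x - partial p (partial j (g m m)) x).

Lemma partial_mass_field p j x : U x ->
  partial p (mass_field j) x = dmass_field p j x.
Proof.
move=> Ux; rewrite partial_sum => [|m]; last by apply: differentiableB; exact: d1.
by apply: eq_bigr => m _; rewrite partialB//; exact: d1.
Qed.

Lemma differentiable_dmass_field p j x : U x -> differentiable (dmass_field p j) x.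
Proof.
by move=> Ux; apply: differentiable_bigsum => m _; apply: differentiableB; exact: d2.
Qed.

Definition dsuperpotential (p i j l : 'I_n) x : R :=
  2^-1 * (partial p (partial j (g i l)) x - partial p (partial i (g j l)) x
          + (i == l)%:R * dmass_field p j x - (j == l)%:R * dmass_field p i x).

Let diffZ (a : R) f x : differentiable f x -> differentiable (fun y : 'rV[R]_n => a * f y) x.
Proof. by move=> df; exact: differentiableZ. Qed.

Lemma differentiable_superpotential i j l x : U x ->
  differentiable (superpotential i j l) x.
Proof.
move=> Ux; apply: diffZ; apply: differentiableB.
  apply: differentiableD; first by apply: differentiableB; exact: d1.
  by apply: diffZ; exact: differentiable_mass_field.
by apply: diffZ; exact: differentiable_mass_field.
Qed.

Lemma differentiable_dsuperpotential p i j l x : U x ->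
  differentiable (dsuperpotential p i j l) x.
Proof.
move=> Ux; apply: diffZ; apply: differentiableB.
  apply: differentiableD; first by apply: differentiableB; exact: d2.
  by apply: diffZ; exact: differentiable_dmass_field.
by apply: diffZ; exact: differentiable_dmass_field.
Qed.

Lemma partial_superpotential p i j l x : U x ->
  partial p (superpotential i j l) x = dsuperpotential p i j l x.
Proof.
move=> Ux.
have dm k := @differentiable_mass_field k x Ux.
have dZ a k : differentiable (fun y => a * mass_field k y) x by exact: diffZ.
have dB : differentiable (fun y => partial j (g i l) y - partial i (g j l) y) x.
  by apply: differentiableB; exact: d1.
have dD := differentiableD dB (dZ (i == l)%:R j).
apply: (etrans (partialZ _ _ (differentiableB dD (dZ (j == l)%:R i)))).
congr (_ * _); apply: (etrans (partialB _ dD (dZ _ _))); congr (_ - _).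
  apply: (etrans (partialD _ dB (dZ _ _))); congr (_ + _).
    exact: (partialB _ (d1 _ _ _ Ux) (d1 _ _ _ Ux)).
  by apply: (etrans (partialZ _ _ (dm j))); rewrite (partial_mass_field _ _ Ux).
by apply: (etrans (partialZ _ _ (dm i))); rewrite (partial_mass_field _ _ Ux).
Qed.

(** The first summand comes from d_p x_l; for p = i, summed over i, it becomes the trace that
    carries the mass. *)
Lemma partial_radial_potential p i j x : U x ->
  partial p (radial_potential i j) x =
  superpotential i j p x + \sum_l x 0 l * dsuperpotential p i j l x.
Proof.
move=> Ux; rewrite partial_sum => [|l]; last first.
  apply: differentiableM; first exact: differentiable_coord.
  exact: differentiable_superpotential.
have -> : superpotential i j p x = \sum_l (p == l)%:R * superpotential i j l x.
  rewrite (bigD1 p)//= eqxx mul1r big1 ?addr0// => l lp.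
  by rewrite eq_sym (negbTE lp) mul0r.
rewrite -big_split/=; apply: eq_bigr => l _.
rewrite partialM; [|exact: differentiable_coord|exact: differentiable_superpotential].
rewrite partial_coord (partial_superpotential _ _ _ _ Ux) [RHS]addrC.
by rewrite [X in _ = _ + X]mulrC.
Qed.

Lemma differentiable_radial_potential i j x : U x ->
  differentiable (radial_potential i j) x.
Proof.
move=> Ux; apply: differentiable_bigsum => l _; apply: differentiableM.
  exact: differentiable_coord.
exact: differentiable_superpotential.
Qed.

Lemma differentiable_partial_radial_potential p i j x : U x ->
  differentiable (partial p (radial_potential i j)) x.
Proof.
move=> Ux; apply: (differentiable_eq_open oU (f := fun x =>
  superpotential i j p x + \sum_l x 0 l * dsuperpotential p i j l x)) => //.
  by move=> y /set_mem Uy; rewrite partial_radial_potential.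
apply: differentiableD; first exact: differentiable_superpotential.
apply: differentiable_bigsum => l _; apply: differentiableM.
  exact: differentiable_coord.
exact: differentiable_dsuperpotential.
Qed.

Lemma sum_delta_l (F : 'I_n -> R) l : \sum_i (i == l)%:R * F i = F l.
Proof.
rewrite (bigD1 l)//= eqxx mul1r big1 ?addr0// => i il.
by rewrite (negbTE il) mul0r.
Qed.

(** The three groups of terms contribute - 1, n and - 1 times U_j / 2. For n > 2 the coefficient can
    be inverted. *)
Lemma superpotential_trace j x : U x ->
  \sum_i superpotential i j i x = (n%:R - 2) / 2 * mass_field j x.
Proof.
move=> Ux; rewrite -mulr_sumr.
have -> : \sum_i (partial j (g i i) x - partial i (g j i) x
      + (i == i)%:R * mass_field j x - (j == i)%:R * mass_field i x) =
    - mass_field j x + n%:R * mass_field j x - mass_field j x.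
  rewrite sumrB big_split/=; congr (_ + _ - _).
  - by rewrite -sumrN; apply: eq_bigr => i _; rewrite opprB (p1C _ j).
  - under eq_bigr do rewrite eqxx mul1r.
    by rewrite sumr_const card_ord mulr_natl.
  - by under eq_bigr do rewrite eq_sym; exact: sum_delta_l.
by field.
Qed.

(** The linearized scalar curvature is div U: exchanging i and m merges the two halves of the
    Laplacian of the trace. *)
Lemma trace_linear_ricci x : U x ->
  \sum_m linear_ricci G m m x = \sum_i dmass_field i i x.
Proof.
move=> Ux.
transitivity (\sum_m \sum_i (partial i (partial m (g m i)) x
   - 2^-1 * partial i (partial i (g m m)) x - 2^-1 * partial m (partial m (g i i)) x)).
  apply: eq_bigr => m _; apply: eq_bigr => i _.
  rewrite !(partial_christoffel1 smG _ _ _ _ Ux) (p2C m i m i Ux).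
  have alg (a b c d : R) : 2^-1 * (a + a - b) - 2^-1 * (c + d - c) =
    a - 2^-1 * b - 2^-1 * d by field.
  exact: alg.
under eq_bigr do rewrite sumrB.
rewrite sumrB [X in X - _]exchange_big/= -sumrB.
apply: eq_bigr => i _; rewrite -sumrB; apply: eq_bigr => m _.
have alg (a b : R) : a - 2^-1 * b - 2^-1 * b = a - b by field.
exact: alg.
Qed.

(** The only place where second derivatives are commuted, through [p2S]. *)
Lemma superpotential_divergence j l x : U x ->
  \sum_i dsuperpotential i i j l x =
  linear_ricci G j l x - 2^-1 * (j == l)%:R * \sum_m linear_ricci G m m x.
Proof.
move=> Ux; rewrite trace_linear_ricci//.
pose e i := partial i (partial j (g i l)) x - partial i (partial i (g j l)) x.
transitivity (2^-1 * (\sum_i e i + dmass_field l j x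
    - (j == l)%:R * \sum_i dmass_field i i x)).
  rewrite -mulr_sumr; congr (_ * _); rewrite sumrB big_split/=; congr (_ + _ - _).
    exact: (sum_delta_l (fun i => dmass_field i j x)).
  by rewrite mulr_sumr.
rewrite mulrBr mulrA; congr (_ - _).
rewrite -big_split/= mulr_sumr; apply: eq_bigr => i _; rewrite /e.
rewrite !(partial_christoffel1 smG _ _ _ _ Ux) (p2S i l j i Ux) (p2C l i j i Ux).
rewrite (p2C i j l i Ux) (p2C j i l i Ux) (p2S j l i i Ux).
have alg (a b c d k : R) : 2^-1 * (a - b + (c - d)) =
  2^-1 * (a + c - b) - 2^-1 * (k + d - k) by field.
exact: alg.
Qed.

(** Two vectors, since on the sphere of radius r the normal is y = w while the position is x = r
    w. *)
Lemma mass_identity (y x : 'rV[R]_n) : U x ->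
  \sum_j \sum_i y 0 j * partial i (radial_potential i j) x =
  (n%:R - 2) / 2 * \sum_j y 0 j * mass_field j x +
  \sum_j \sum_l y 0 j * x 0 l * (linear_ricci G j l x
    - 2^-1 * (j == l)%:R * \sum_m linear_ricci G m m x).
Proof.
move=> Ux; rewrite mulr_sumr -big_split/=; apply: eq_bigr => j _.
under eq_bigr do rewrite partial_radial_potential// mulrDr.
rewrite big_split/= -mulr_sumr superpotential_trace// mulrCA; congr (_ + _).
rewrite -mulr_sumr exchange_big/= mulr_sumr; apply: eq_bigr => l _.
by rewrite -mulr_sumr superpotential_divergence// mulrA.
Qed.

End MassIdentity.

(** * Vanishing of the mass *)

Section Flux.
Variable R : realType.

Lemma sphere_C1_scale n (V : set 'rV[R]_n) (f : 'rV[R]_n -> R) r :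
  (forall w, enorm w = 1 -> V (r *: w)) ->
  (forall x, V x -> differentiable f x) ->
  (forall i x, V x -> {for x, continuous (partial i f)}) ->
  sphere_C1 (fun w => f (r *: w)) (fun i w => r * partial i f (r *: w)).
Proof.
move=> Vr df cf w w1.
have scaleE (v : 'rV[R]_n) : r *: v = 0 + v *m r%:M.
  by rewrite add0r mul_mx_scalar.
have E : (fun w => f (r *: w)) = (fun w => f (0 + w *m r%:M)).
  by apply/funext => v; rewrite scaleE.
have d : differentiable f (0 + w *m r%:M) by rewrite -scaleE; exact/df/Vr.
have [dF pF] := diff_affine_comp d.
split=> [|i|i].
- by rewrite E.
- rewrite E pF scaleE (bigD1 i)//= mxE eqxx mulr1n big1 ?addr0// => j ji.
  by rewrite mxE eq_sym (negbTE ji) mul0r.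
- apply: (@cvgM _ _ (nbhs w)); first exact: cvg_cst.
  apply: (@continuous_comp _ _ _ (fun v : 'rV[R]_n => r *: v) (partial i f)).
    exact: scaler_continuous.
  exact/cf/Vr.
Qed.

Lemma sphere_continuous_scale n (V : set 'rV[R]_n) (f : 'rV[R]_n -> R) r :
  (forall w, enorm w = 1 -> V (r *: w)) ->
  (forall x, V x -> {for x, continuous f}) -> sphere_continuous (fun w => f (r *: w)).
Proof.
move=> Vr cf w w1; apply: (@continuous_comp _ _ _ (fun v : 'rV[R]_n => r *: v) f).
  exact: scaler_continuous.
exact/cf/Vr.
Qed.

Lemma outside_scale n (R0 r : R) (w : 'rV[R]_n) : 0 < r -> R0 < r -> enorm w = 1 ->
  outside R0 (r *: w).
Proof. by move=> r0 Rr w1; rewrite /outside/= enormZ w1 mulr1 gtr0_norm. Qed.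

Lemma sum_symmetrize m (a : 'I_m -> 'I_m -> R) (r : R) :
  \sum_j \sum_i (r * a j i + r * a i j) = 2 * r * \sum_j \sum_i a j i.
Proof.
under eq_bigr do rewrite big_split/=.
rewrite big_split/= [X in _ + X]exchange_big/= -mulr2n -[LHS]mulr_natl -mulrA.
congr (_ * _); rewrite mulr_sumr.
by apply: eq_bigr => j _; rewrite mulr_sumr.
Qed.

Section MassFlux.
Variables (k : nat) (G : 'rV[R]_k.+1 -> 'M[R]_k.+1) (R0 tau : R).
Local Notation U := (@outside R k.+1 R0).
Local Notation g i j := (fun y => G y i j).
Local Notation A := (radial_potential G).
Hypotheses (R00 : 0 < R0) (tau0 : 0 < tau)
  (smG : forall i j, smooth_on U (g i j))
  (symG : forall x, U x -> (G x)^T = G x)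
  (uG : forall x, U x -> G x \in unitmx)
  (ricG : forall x, U x -> ricci G x = 0)
  (decG : forall s i j, is_big_O (partials s (fun x => G x i j - (i == j)%:R))
    (- tau - (size s)%:R)).

Lemma partial_radial_potentialC p i j x : U x ->
  partial p (A j i) x = - partial p (A i j) x.
Proof.
move=> Ux; have d := differentiable_radial_potential smG i j Ux.
rewrite -mulN1r -(partialZ _ _ d); congr (partial p _ x).
by apply/funext => y; rewrite mulN1r radial_potentialC.
Qed.

Lemma sphere_integral_radial_potential r : R0 < r ->
  sphere_integral (fun w => \sum_j \sum_i w 0 j * partial i (A i j) (r *: w)) = 0.
Proof.
move=> Rr; have r0 : 0 < r by exact: lt_trans Rr.
have Ur w : enorm w = 1 -> U (r *: w) by exact: outside_scale.
pose D i j p (w : 'rV[R]_k.+1) : R := r * partial p (A i j) (r *: w).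
have C1 i j : sphere_C1 (fun w => A i j (r *: w)) (D i j).
  apply: (sphere_C1_scale Ur) => [x Ux|p x Ux].
    exact: differentiable_radial_potential.
  exact/differentiable_continuous/differentiable_partial_radial_potential.
pose F i j (w : 'rV[R]_k.+1) : R := w 0 j * D i j i w - w 0 i * D i j j w.
have cD i j p : sphere_continuous (D i j p) by exact: sphere_C1_continuousD (C1 i j).
have cF i j : sphere_continuous (F i j).
  by apply: sphere_continuousD; last apply: sphere_continuousN;
    apply: sphere_continuousM => //; exact: sphere_continuous_coord.
have F0 i j : sphere_integral (F i j) = 0.
  have [ij|ij] := eqVneq i j; last exact: sphere_integral_rotation (C1 i j) ij.
  rewrite -[RHS](sphere_integral0 R k); apply: eq_sphere_integral => w _.
  by rewrite /F ij subrr.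
(* The chain rule for w -> r w produces the factor r, and antisymmetry of A makes the double sum
   count the integrand twice. *)
transitivity (sphere_integral (fun w => (2 * r)^-1 * \sum_j \sum_i F i j w)).
  apply: eq_sphere_integral => w w1.
  have -> : \sum_j \sum_i F i j w =
      2 * r * \sum_j \sum_i w 0 j * partial i (A i j) (r *: w).
    pose a j i := w 0 j * partial i (A i j) (r *: w).
    rewrite -(sum_symmetrize a); apply: eq_bigr => j _; apply: eq_bigr => i _.
    have alg (p q X Y Z : R) : Z = - Y ->
        p * (r * X) - q * (r * Y) = r * (p * X) + r * (q * Z).
      by move=> ->; ring.
    exact: (alg _ _ _ _ _ (partial_radial_potentialC j i j (Ur _ w1))).
  by rewrite mulrA mulVf ?mul1r// mulf_neq0// gt_eqF.
have cS j : sphere_continuous (fun w => \sum_i F i j w).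
  by apply: sphere_continuous_sum => i; exact: cF.
rewrite sphere_integralZ; last exact: sphere_continuous_sum.
rewrite sphere_integral_sum// big1 ?mulr0// => j _.
by rewrite sphere_integral_sum// big1.
Qed.

(** Absolute values inside the sum make the bound independent of direction: contraction with w and r
    w then costs a factor r only. *)
Definition mass_error x : R := \sum_j \sum_l `|linear_ricci G j l x
    - 2^-1 * (j == l)%:R * \sum_m linear_ricci G m m x|.

Lemma mass_error_decay : is_big_O mass_error (- (2 * tau) - 2).
Proof.
have P j l := linear_ricci_decay tau0 smG uG ricG decG j l.
apply: big_O_sum => j; apply: big_O_sum => l.
have : is_big_O (fun x => linear_ricci G j l x
    - 2^-1 * (j == l)%:R * \sum_m linear_ricci G m m x) (- (2 * tau) - 2).
  by apply: big_OB => //; apply: big_OZ; apply: big_O_sum.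
by move=> [K [r [r0 H]]]; exists K, r; split=> // x /H; rewrite normr_id.
Qed.

Lemma sphere_integral_adm r : R0 < r ->
  sphere_integral (fun w => adm_integrand G (r *: w)) =
  sphere_integral (fun w => \sum_j w 0 j * mass_field G j (r *: w)).
Proof.
move=> Rr; have r0 : 0 < r by exact: lt_trans Rr.
apply: eq_sphere_integral => w w1; apply: eq_bigr => j _.
rewrite -mulr_suml mulrC; congr (_ * _).
by rewrite mxE enormZ w1 mulr1 gtr0_norm// mulrAC mulfV ?mul1r// gt_eqF.
Qed.

Lemma adm_sphere_bound : (2 < k.+1)%N -> exists C s : R, [/\ 0 <= C, 0 < s &
  forall r, s <= r -> `|sphere_integral_r r (adm_integrand G)| <=
    C * r `^ (k.+1%:R - 2 - 2 * tau)].
Proof.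
move=> n2; have [[C C0 bd] _] := sphere_bounded_linear R k.
have /big_OP[K [r1 [K0 r11 HK]]] := mass_error_decay.
pose c : R := (k.+1%:R - 2) / 2.
have c0 : 0 < c by rewrite divr_gt0// subr_gt0 ltr_nat.
(* C bounds the sphere integral, K the error, and c^-1 undoes the factor (n - 2)/2 in front of U. *)
exists (c^-1 * (C * K)), (Num.max r1 (R0 + 1)); split.
- by rewrite !mulr_ge0// invr_ge0 ltW.
- by rewrite lt_max (lt_le_trans ltr01).
move=> r; rewrite ge_max => /andP[rr1 rR].
have Rr : R0 < r by apply: lt_le_trans rR; rewrite ltrDl.
have r0 : 0 < r by exact: lt_trans Rr.
have rn0 : r != 0 by rewrite gt_eqF.
have Ur w : enorm w = 1 -> U (r *: w) by exact: outside_scale.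
rewrite /sphere_integral_r sphere_integral_adm//.
pose S1 (w : 'rV[R]_k.+1) : R := \sum_j \sum_i w 0 j * partial i (A i j) (r *: w).
pose S2 (w : 'rV[R]_k.+1) : R := \sum_j w 0 j * mass_field G j (r *: w).
have cS1 : sphere_continuous S1.
  apply: sphere_continuous_sum => j; apply: sphere_continuous_sum => i.
  apply: sphere_continuousM; first exact: sphere_continuous_coord.
  apply: (sphere_continuous_scale Ur) => x Ux.
  exact/differentiable_continuous/differentiable_partial_radial_potential.
have cS2 : sphere_continuous S2.
  apply: sphere_continuous_sum => j.
  apply: sphere_continuousM; first exact: sphere_continuous_coord.
  apply: (sphere_continuous_scale Ur) => x Ux.
  exact/differentiable_continuous/differentiable_mass_field.
(* By [mass_identity] this combination is the error term alone, while its integral is - c times that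
   of S2. *)
have cS : sphere_continuous (fun w => S1 w + (- c) * S2 w).
  apply: sphere_continuousD => //; apply: sphere_continuousM => //.
  exact: sphere_continuous_cst.
have I12 : sphere_integral (fun w => S1 w + (- c) * S2 w) = - (c * sphere_integral S2).
  by rewrite sphere_integral_lin// sphere_integral_radial_potential// add0r mulNr.
have b12 w : enorm w = 1 -> `|S1 w + (- c) * S2 w| <= K * r `^ (- (2 * tau) - 1).
  move=> w1; have e1 : enorm (r *: w) = r by rewrite enormZ w1 mulr1 gtr0_norm.
  rewrite {1}/S1 (mass_identity smG symG w (Ur w w1)) mulNr addrAC subrr add0r.
  apply: (@le_trans _ _ (r * mass_error (r *: w))).
    rewrite mulr_sumr (le_trans (ler_norm_sum _ _ _))//; apply: ler_sum => j _.
    rewrite mulr_sumr (le_trans (ler_norm_sum _ _ _))//; apply: ler_sum => l _.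
    rewrite !normrM; apply: ler_wpM2r => //; rewrite -[leRHS]mul1r.
    apply: ler_pM => //; first by rewrite -w1 coord_le_enorm.
    by rewrite -[leRHS]e1 coord_le_enorm.
  have -> : - (2 * tau) - 1 = 1 + (- (2 * tau) - 2) by ring.
  have rD : r `^ (1 + (- (2 * tau) - 2)) = r * r `^ (- (2 * tau) - 2).
    by rewrite powRD ?rn0 ?implybT// powRr1// ltW.
  rewrite rD [leRHS]mulrCA; apply: ler_wpM2l; first exact: ltW.
  apply: (le_trans (ler_norm _)); rewrite -[in leRHS]e1; apply: HK.
  by rewrite e1.
have := bd _ _ cS b12; rewrite I12 normrN normrM gtr0_norm// => B.
rewrite normrM ger0_norm ?exprn_ge0 ?(ltW r0)//.
have -> : k.+1%:R - 2 - 2 * tau = k%:R + (- (2 * tau) - 1) :> R.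
  by rewrite -natr1; ring.
rewrite powRD ?rn0 ?implybT// powR_mulrn ?(ltW r0)//.
rewrite [leRHS]mulrCA; apply: ler_wpM2l; first by rewrite exprn_ge0 ?(ltW r0).
rewrite -[leRHS]mulrA ler_pdivlMl//; apply: (le_trans B).
by rewrite mulrA.
Qed.

End MassFlux.

Lemma adm_sphere_cvg0 n (G : 'rV[R]_n -> 'M[R]_n) (R0 tau : R) : (2 < n)%N ->
  0 < R0 -> (n%:R - 2) / 2 < tau ->
  (forall i j, smooth_on (outside R0) (fun y => G y i j)) ->
  (forall x, outside R0 x -> (G x)^T = G x) ->
  (forall x, outside R0 x -> G x \in unitmx) ->
  (forall x, outside R0 x -> ricci G x = 0) ->
  (forall s i j, is_big_O (partials s (fun x => G x i j - (i == j)%:R))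
    (- tau - (size s)%:R)) ->
  sphere_integral_r r (adm_integrand G) @[r --> +oo] --> (0 : R).
Proof.
case: n G => // k G n2 R00 htau smG symG uG ricG decG.
have tau0 : 0 < tau.
  by apply: lt_trans htau; rewrite divr_gt0// subr_gt0 ltr_nat.
have [C [s [C0 s0 B]]] := adm_sphere_bound R00 tau0 smG symG uG ricG decG n2.
have b0 : k.+1%:R - 2 - 2 * tau < 0.
  by move: htau => h; lra.
apply/cvgrPdist_le => e e0.
have C1 : 0 < C + 1 by rewrite ltr_wpDl.
have [q q0 Hq] := powR_small b0 (divr_gt0 e0 C1).
near=> r.
have rs : s <= r by near: r; apply: nbhs_pinfty_ge; exact: num_real.
have rq : q <= r by near: r; apply: nbhs_pinfty_ge; exact: num_real.
rewrite sub0r normrN (le_trans (B r rs))// (le_trans (ler_wpM2l C0 (Hq r rq)))//.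
by rewrite mulrA ler_pdivrMr// mulrC ler_pM2l// lerDl.
Unshelve. all: by end_near. Qed.

End Flux.

(** * The mass of a Ricci-flat ALE end *)

Section ALEMass.
Variables (R : realType) (n : nat) (M : manifold R n) (g : metric M) (tau : R).
Variable E : ALE g tau.
Local Notation G := (pullback g (ale_map E)).
Local Notation Out := (outside (ale_radius E)).

Lemma atlas_open (c : chart R n M) : atlas c -> open (cimg c).
Proof. by move=> /atlas_chart[]. Qed.

(** This and the next three properties are local, hence read off in the chart that [ale_chart] gives
    around x. *)
Lemma pullback_smooth i j : smooth_on Out (fun x => G x i j).
Proof.
move=> s x /ale_chart[c [ac cx cE]].
have e : {in cimg c, (fun x => g c x i j) =1 (fun x => G x i j)}.
  by move=> y /set_mem/cE[_ ->].
exact: (smooth_on_eq (atlas_open ac) e (@comp_smooth _ _ _ g c ac i j) s cx).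
Qed.

Lemma pullback_sym x : Out x -> (G x)^T = G x.
Proof.
move=> /ale_chart[c [ac cx /(_ _ cx)[_ ->]]].
exact: comp_sym.
Qed.

Lemma pullback_unit x : Out x -> G x \in unitmx.
Proof.
move=> /ale_chart[c [ac cx /(_ _ cx)[_ ->]]].
rewrite -row_free_unit -kermx_eq0; apply/rowV0P => v /sub_kermxP vA.
apply/eqP/negPn/negP => v0; have := metric_pos g ac cx v0.
by rewrite vA mul0mx mxE ltxx.
Qed.

Lemma pullback_ricci_flat : ricci_flat g -> forall x, Out x -> ricci G x = 0.
Proof.
move=> rf x /ale_chart[c [ac cx cE]].
rewrite (ricci_eq_open (atlas_open ac) (G' := g c)) ?rf//; last exact/mem_set.
by move=> y /set_mem/cE[].
Qed.

Lemma ale_mass_zero : (2 < n)%N -> (n%:R - 2) / 2 < tau -> ricci_flat g ->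
  adm_mass_is E 0.
Proof.
move=> n2 htau rf; rewrite /adm_mass_is /adm_flux -[X in _ --> X](mul0r (#|` ale_group E|%:R)^-1).
apply: cvgM; last exact: cvg_cst.
apply: (adm_sphere_cvg0 n2 (ale_radius_gt0 E) htau).
- exact: pullback_smooth.
- exact: pullback_sym.
- exact: pullback_unit.
- exact: pullback_ricci_flat.
- exact: ale_decay.
Qed.

End ALEMass.

Theorem proposition6p5 (R : realType) (n : nat) (hn : (4 <= n)%N)
  (M : manifold R n) (g : metric M) (tau : R) (E : ALE g tau)
  (htau : (n%:R - 2) / 2 < tau)
  (hcomplete : complete g)
  (hricci : ricci_flat g)
  (h : sym2 M) (alpha : R)
  (hlich : forall c x, atlas c -> cimg c x -> lichnerowicz (g c) (h c) x = 0)
  (hdiv : forall c x, atlas c -> cimg c x -> divergence (g c) (h c) x = 0)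
  (htr : forall c x, atlas c -> cimg c x -> trace_g (g c) (h c) x = 0)
  (halpha : n%:R / 2 < alpha)
  (hdecay : tensor_big_O E h (- alpha))
  (hcurv : forall c x, atlas c -> cimg c x ->
     inner_g (g c) x (lich_curv (g c) (h c) x) (h c x) <= 0) :
  sym2_zero h \/ adm_mass_is E 0.
Proof.
right; apply: ale_mass_zero => //; exact: leq_trans hn.
Qed.
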